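(* Let $k\ge 1$ and let $\Gamma$ be a general Martens-special chain of cycles of type $k$ and genus $g$. Then $\Gamma$ is a divisorial complete metric graph.
   Context: Divisors on metric graphs. A metric graph is a compact connected metric space obtained from a finite graph by giving every edge a positive length. A divisor $D$ on a metric graph $\Gamma$ is a finite formal $\mathbb{Z}$-combination of points of $\Gamma$; its degree is the sum of its coefficients; it is effective if all coefficients are $\ge 0$. A rational function on $\Gamma$ is a continuous, piecewise affine function $f:\Gamma\to\mathbb{R}$ with integer slopes and finitely many pieces; $\mathrm{div}(f)$ is the divisor whose coefficient at a point $p$ is the sum of the outgoing slopes of $f$ at $p$ (the sign convention is irrelevant). Divisors $D_1,D_2$ are (linearly) equivalent if $D_1-D_2=\mathrm{div}(f)$ for some rational function $f$. The rank $\mathrm{rk}(D)$ is $-1$ if $D$ is not equivalent to an effective divisor; otherwise it is the largest integer $r\ge 0$ such that for each effective divisor $E$ of degree $r$ there is an effective divisor $D'$ equivalent to $D$ with $D'-E$ effective. Clifford index. The genus $g$ of $\Gamma$ is its first Betti number. For a divisor $D$ of degree $d$ and rank $r\ge 0$ put $\mathrm{Cliff}(D)=d-2r$. The Clifford index $\mathrm{Cliff}(\Gamma)$ is the minimal value of $\mathrm{Cliff}(D)$ over divisors $D$ of degree $d$ and rank $r$ satisfying $r\ge 1$ and $g-d+r-1\ge 1$. Divisorial completeness. A metric graph $\Gamma$ of genus $g$ and Clifford index $c$ is divisorial complete if for all integers $d$ and $r$ there exists a divisor on $\Gamma$ of degree $d$ and rank $r$ if and only if $(d,r)$ satisfies the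 restrictions coming from the Riemann-Roch Theorem on metric graphs and from the Clifford index of $\Gamma$. Concretely, $\Gamma$ is divisorial complete if and only if there exists a divisor on $\Gamma$ of degree $d$ and rank (exactly) $r$ in each of the following cases: (i) $d\ge g$ and $r=d-g$; (ii) $0\le d\le g$ and $r=0$; (iii) $g\le d\le 2g-2$ and $r=d-g+1$; (iv) $r\ge 1$ and $c+2r\le d\le g+r-2$. Chains of cycles. A chain of cycles $\Gamma$ of genus $g\ge 1$ is a metric graph consisting of $g$ cycles $C_1,\dots,C_g$ such that, for $1\le i\le g-1$, $C_i$ and $C_{i+1}$ are connected by a segment going from a point $w_i\in C_i$ to a point $v_{i+1}\in C_{i+1}$; moreover points $v_1\in C_1$ and $w_g\in C_g$ are chosen, and $v_i\ne w_i$ for $1\le i\le g$. Each cycle is given an orientation. Its torsion profile $\underline m=(m_2,\dots,m_g)$ is defined as follows: let $l_i$ be the length of $C_i$ and $l(v_i,w_i)$ the length of the positively oriented arc on $C_i$ from $v_i$ to $w_i$; if $l_i$ is an irrational multiple of $l(v_i,w_i)$ then $m_i=0$, otherwise $m_i$ is the minimal positive integer such that $m_i\cdot l(v_i,w_i)$ is an integer multiple of $l_i$. Martens-special chains. A chain of cycles of genus $g$ is a Martens-special chain of cycles of type $k$ ($k\ge 1$) if there are integers $3\le j_1\le j_2\le\dots\le j_k\le g-2$ with $j_{i+1}-j_i\ge 2$ for $1\le i\le k-1$ such that $m_i\ne 2$ for $i\in\{j_1,\dots,j_k\}$ and $m_i=2$ for $i\in\{2,\dots,g\}\setminus\{j_1,\dots,j_k\}$.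 It is called general if $m_i=0$ whenever $m_i\ne 2$. *)

(* Defs.v *)
(* The real numbers are represented by an arbitrary R : realType. *)
From mathcomp Require Import all_boot all_order all_algebra.
From mathcomp Require Import boolp classical_sets reals.
From mathcomp Require Import freeg.

Set Implicit Arguments.
Unset Strict Implicit.
Unset Printing Implicit Defensive.

Import Order.TTheory GRing.Theory Num.Theory.
Local Open Scope ring_scope.

(* A compact connected metric graph, presented by a finite connected multigraph
   (loops and parallel edges allowed) with positive edge lengths.  The edge e is
   a copy of the segment [0, elen e], with 0 glued to src e and elen e glued to
   tgt e; the orientation of the edges is auxiliary. *)
Record metric_graph (R : realType) := MetricGraph {
  vertex : finType;
  edge : finType;
  src : edge -> vertex;
  tgt : edge -> vertex;
  elen : edge -> R;
  elen_gt0 : forall e, 0 < elen e;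
  vertex_nonempty : (0 < #|vertex|)%N;
  vertex_connected : forall x y,
    connect [rel u v | [exists e, ((src e == u) && (tgt e == v))
                               || ((src e == v) && (tgt e == u))]] x y
}.

Section MetricGraphs.
Variables (R : realType) (G : metric_graph R).

(* A point of the space: a vertex, or a point in the interior of an edge. *)
Definition point : choiceType :=
  (vertex G + {x : edge G * R | (0 < x.2 < elen x.1)%R})%type.

(* The point at distance t from the source along the edge e, 0 <= t <= elen e. *)
Definition edge_pt (e : edge G) (t : R) : point :=
  if insub (e, t) is Some x then inr x
  else inl (if t <= 0 then src e else tgt e).

(* First Betti number: the dimension of H_1 = ker (Q^edge -> Q^vertex). *)
Definition boundary : 'M[rat]_(#|edge G|, #|vertex G|) :=
  \matrix_(i, j) ((tgt (enum_val i) == enum_val j)%:R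
                  - (src (enum_val i) == enum_val j)%:R).

Definition genus : nat := \rank (kermx boundary).

Definition divisor := {freeg point / int}.

Definition effective (D : divisor) : Prop := forall p, 0 <= coeff p D.

(* Being affine on each of finitely many closed intervals covering [0, l]
   includes continuity on [0, l]. *)
Definition piecewise_affine (l : R) (h : R -> R) : Prop :=
  exists (n : nat) (t : nat -> R) (s : nat -> int),
    [/\ t 0%N = 0, t n = l,
        (forall i, (i < n)%N -> t i < t i.+1)
      & (forall i x, (i < n)%N -> t i <= x <= t i.+1 ->
           h x = h (t i) + (s i)%:~R * (x - t i))].

(* Continuity of f at the vertices is built in: for each edge e the restriction
   to the closed edge takes the values f (src e) and f (tgt e) at its ends. *)
Definition rational_function (f : point -> R) : Prop :=
  forall e, piecewise_affine (elen e) (fun t => f (edge_pt e t)).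

(* The slope of h at 0 to the right (for h affine with integral slope there). *)
Definition slope (h : R -> R) : int :=
  xget 0 [set s : int | exists2 eps : R, 0 < eps &
            forall u, 0 <= u <= eps -> h u = h 0 + s%:~R * u]%classic.

(* The coefficient of div f at p: the sum of the slopes of f along all
   directions leaving p, a loop at a vertex contributing two directions. *)
Definition div_coeff (f : point -> R) (p : point) : int :=
  match p with
  | inl v =>
      \sum_(e | src e == v) slope (fun u => f (edge_pt e u))
    + \sum_(e | tgt e == v) slope (fun u => f (edge_pt e (elen e - u)))
  | inr x =>
      let: (e, t) := val x in
      slope (fun u => f (edge_pt e (t + u)))
    + slope (fun u => f (edge_pt e (t - u)))
  end.

Definition lin_equiv (D1 D2 : divisor) : Prop :=
  exists2 f, rational_function f & forall p, coeff p (D1 - D2) = div_coeff f p.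

Definition rank_at_least (D : divisor) (r : nat) : Prop :=
  forall E : divisor, effective E -> deg E = r%:Z ->
    exists D' : divisor, [/\ effective D', lin_equiv D' D & effective (D' - E)].

Definition equiv_effective (D : divisor) : Prop :=
  exists2 D' : divisor, effective D' & lin_equiv D D'.

(* rk D = r *)
Definition has_rank (D : divisor) (r : int) : Prop :=
  (~ equiv_effective D /\ r = -1)
  \/ (equiv_effective D /\
      exists n : nat, [/\ r = n%:Z, rank_at_least D n
                        & forall m, rank_at_least D m -> (m <= n)%N]).

Definition contributes (D : divisor) (r : int) : Prop :=
  [/\ has_rank D r, 1 <= r & 1 <= (genus%:Z - deg D + r - 1)].

(* Cliff G = c, i.e. the minimum exists and equals c. *)
Definition clifford_index (c : int) : Prop :=
  (exists (D : divisor) (r : int), contributes D r /\ c = deg D - 2 * r)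
  /\ (forall (D : divisor) (r : int), contributes D r -> c <= deg D - 2 * r).

Definition divisorial_complete : Prop :=
  exists2 c : int, clifford_index c &
  forall d r : int,
    [\/ genus%:Z <= d /\ r = d - genus%:Z,
        0 <= d <= genus%:Z /\ r = 0,
        genus%:Z <= d <= 2 * genus%:Z - 2 /\ r = d - genus%:Z + 1
      | 1 <= r /\ c + 2 * r <= d <= genus%:Z + r - 2] ->
    exists2 D : divisor, deg D = d & has_rank D r.

End MetricGraphs.

(* Metric data of a chain of g oriented cycles C_1, ..., C_g; only the indices
   1 <= i <= g (1 <= i < g for seg_len) matter.  cyc_len i is the length of C_i,
   arc_len i that of the positively oriented arc from v_i to w_i, seg_len i that
   of the segment from w_i to v_(i+1).  The strict bounds on arc_len i say that
   v_i and w_i are distinct. *)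
Record chain_of_cycles (R : realType) (g : nat) := ChainOfCycles {
  chain_genus_gt0 : (0 < g)%N;
  cyc_len : nat -> R;
  arc_len : nat -> R;
  seg_len : nat -> R;
  arc_lenP : forall i, (1 <= i <= g)%N -> 0 < arc_len i < cyc_len i;
  seg_lenP : forall i, (1 <= i < g)%N -> 0 < seg_len i
}.

Section ChainGraph.
Variables (R : realType) (g : nat) (C : chain_of_cycles R g).

(* For i : 'I_g, (i, false) is v_(i+1) and (i, true) is w_(i+1). *)
Definition chain_vertex : finType := ('I_g * bool)%type.

(* inl (i, true) is the positively oriented arc of C_(i+1) from v_(i+1) to
   w_(i+1), inl (i, false) the one from w_(i+1) to v_(i+1), and inr i the
   segment from w_(i+1) to v_(i+2). *)
Definition chain_edge : finType := ('I_g * bool + 'I_g.-1)%type.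

Lemma chain_next_subproof (i : 'I_g.-1) : (i.+1 < g)%N.
Proof. by case: i => i /=; rewrite ltn_predRL. Qed.

Definition chain_this (i : 'I_g.-1) : 'I_g := widen_ord (leq_pred g) i.
Definition chain_next (i : 'I_g.-1) : 'I_g := Ordinal (chain_next_subproof i).

Definition chain_src (e : chain_edge) : chain_vertex :=
  match e with
  | inl (i, b) => (i, ~~ b)
  | inr i => (chain_this i, true)
  end.

Definition chain_tgt (e : chain_edge) : chain_vertex :=
  match e with
  | inl (i, b) => (i, b)
  | inr i => (chain_next i, false)
  end.

Definition chain_elen (e : chain_edge) : R :=
  match e with
  | inl (i, b) => if b then arc_len C i.+1 else cyc_len C i.+1 - arc_len C i.+1
  | inr i => seg_len C i.+1
  end.

Lemma chain_elen_gt0 e : 0 < chain_elen e.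
Proof.
case: e => [[i b]|i] /=; last by rewrite seg_lenP //= chain_next_subproof.
have /andP[a0 al] : 0 < arc_len C i.+1 < cyc_len C i.+1.
  by apply: arc_lenP; rewrite /= ltn_ord.
by case: b => //; rewrite subr_gt0.
Qed.

Lemma chain_vertex_nonempty : (0 < #|chain_vertex|)%N.
Proof. by rewrite card_prod card_ord card_bool muln_gt0 (chain_genus_gt0 C). Qed.

Lemma chain_connected x y :
  connect [rel u v | [exists e, ((chain_src e == u) && (chain_tgt e == v))
                             || ((chain_src e == v) && (chain_tgt e == u))]] x y.
Proof.
set r := (X in connect X).
have rS : connect_sym r.
  by apply: sym_connect_sym => u v; apply/idP/idP => /existsP[e He];
    apply/existsP; exists e; rewrite orbC.
have g0 := chain_genus_gt0 C; pose o := (Ordinal g0, false) : chain_vertex.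
suff H z : connect r o z by apply: connect_trans (H y); rewrite rS.
have arc i b c : connect r (i, b) (i, c).
  case: (eqVneq b c) => [->//|bc]; apply: connect1.
  apply/existsP; exists (inl (i, c)) => /=.
  by move: bc; case: b; case: c => //= _; rewrite !eqxx.
case: z => -[n]; elim: n => [|n IHn] n_lt b.
  by rewrite (_ : Ordinal n_lt = Ordinal g0) ?arc //; apply: val_inj.
have n_lt' := ltnW n_lt.
apply: connect_trans (IHn n_lt' true) _.
apply: connect_trans (arc _ false b); apply: connect1; apply/existsP.
have n_ltp : (n < g.-1)%N by rewrite ltn_predRL.
exists (inr (Ordinal n_ltp)) => /=.
by apply/orP; left; rewrite !xpair_eqE -!val_eqE /= !eqxx.
Qed.

Definition chain_graph : metric_graph R :=
  MetricGraph chain_elen_gt0 chain_vertex_nonempty chain_connected.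

(* The torsion m_i; it is only used for 2 <= i <= g. *)
Definition torsion (i : nat) : nat :=
  if `[< @irrational R (cyc_len C i / arc_len C i) >] then 0%N else
  let S := [set m : nat | (0 < m)%N /\
              exists z : int, m%:R * arc_len C i = z%:~R * cyc_len C i]%classic in
  xget 0%N [set m | S m /\ forall n, S n -> (m <= n)%N]%classic.

(* The exceptional indices j_1, ..., j_k are j 1, ..., j k; the bound
   j n <= g - 2 is written without truncated subtraction. *)
Definition martens_special (k : nat) : Prop :=
  (1 <= k)%N /\
  exists j : nat -> nat,
    [/\ forall n, (1 <= n <= k)%N -> (3 <= j n)%N /\ (j n + 2 <= g)%N,
        forall n, (1 <= n < k)%N -> (j n + 2 <= j n.+1)%N,
        forall n, (1 <= n <= k)%N -> torsion (j n) <> 2%N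
      & forall i, (2 <= i <= g)%N ->
          (forall n, (1 <= n <= k)%N -> i <> j n) -> torsion i = 2%N].

Definition general_chain : Prop :=
  forall i, (2 <= i <= g)%N -> torsion i <> 2%N -> torsion i = 0%N.

End ChainGraph.

(* Main.v *)
(** Linear equivalence on a chain of cycles is governed by an Abel-Jacobi
    theorem: two divisors are equivalent iff they have the same degree and, for
    every cycle, the same image in the circle group under the retraction onto
    that cycle.  Distributing chips over the cycles from right to left turns the
    rank into a particle process.  Particle [q] starts at position [q], and at
    every cycle each particle moves one step to the right, except that it stays
    if its position, times the arc from [v] to [w], equals the class of the
    divisor on that cycle and the particle behind it leaves a gap.  A divisor
    has rank at least [r] iff particle [r] ends at a position at most the degree.

    The delays of the particles are the rows of a Young diagram to which a cycle
    of torsion 2 adds boxes of a single diagonal parity, and one of torsion 0 at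
    most one box.  A divisor contributing to the Clifford index fills an
    [A * B] rectangle with [A, B >= 2].  Following the lengths of the diagram
    along the two boundary paths of this rectangle shows that the exceptional
    cycles do not help, so [A + B - 1 <= g - k] and the Clifford index is at
    least [k].  Conversely, letting the exceptional cycles add nothing, the
    other ones fill the rectangle one antidiagonal at a time. *)

From mathcomp Require Import all_boot all_order all_algebra reals.
From mathcomp Require Import boolp classical_sets freeg.
From mathcomp Require Import zify ring lra.
Require Import Defs.

Set Implicit Arguments.
Unset Strict Implicit.
Unset Printing Implicit Defensive.

Import Order.TTheory GRing.Theory Num.Theory.
Local Open Scope ring_scope.

(** * Sums over the support of a divisor *)

Section WeightedSum.
Variables (K : choiceType) (V : zmodType).
Implicit Types (F : K -> V) (D : {freeg K / int}).

Definition wsum F D : V := \sum_(p <- dom D) F p *~ coeff p D.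

Lemma wsumE F D (s : seq K) :
  uniq s -> {subset dom D <= s} -> wsum F D = \sum_(p <- s) F p *~ coeff p D.
Proof.
move=> us sub; rewrite /wsum (bigID (mem (dom D)) predT) /=.
rewrite [X in _ = X](bigID (mem (dom D)) predT) /=.
rewrite -[X in X + _ = _]big_filter -[X in _ = X + _]big_filter.
congr (_ + _).
  apply: perm_big; apply: uniq_perm; rewrite ?filter_uniq ?uniq_dom // => p.
  by rewrite !mem_filter andbb; case: (boolP (p \in dom D)) => //= /sub ->.
by rewrite !big1 // => p /coeff_outdom ->; rewrite mulr0z.
Qed.

Lemma wsumD F : {morph wsum F : D1 D2 / D1 + D2}.
Proof.
move=> D1 D2; pose s := undup (dom D1 ++ dom D2 ++ dom (D1 + D2)).
have us : uniq s by apply: undup_uniq.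
rewrite !(@wsumE _ _ s) // => [|p pD|p pD|p pD];
  rewrite ?mem_undup ?mem_cat ?pD ?orbT // -big_split.
by apply: eq_bigr => p _; rewrite coeffD mulrzDr.
Qed.

Lemma wsum0 F : wsum F 0 = 0.
Proof. by rewrite /wsum dom0 big_nil. Qed.

Lemma wsumN F : {morph wsum F : D / - D}.
Proof. by move=> D; apply/eqP; rewrite -addr_eq0 -wsumD addNr wsum0. Qed.

Lemma wsumB F : {morph wsum F : D1 D2 / D1 - D2}.
Proof. by move=> D1 D2; rewrite wsumD wsumN. Qed.

Lemma wsumU F k p : wsum F << k *g p >> = F p *~ k.
Proof.
have [->|k0] := eqVneq k 0; first by rewrite freegU0 wsum0 mulr0z.
by rewrite /wsum domU // big_seq1 coeffU eqxx mulr1.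
Qed.

Lemma wsum_sum F I (r : seq I) (E : I -> {freeg K / int}) :
  wsum F (\sum_(i <- r) E i) = \sum_(i <- r) wsum F (E i).
Proof. exact: (big_morph _ (wsumD F) (wsum0 F)). Qed.

Lemma eq_wsum F1 F2 D : F1 =1 F2 -> wsum F1 D = wsum F2 D.
Proof. by move=> eqF; apply: eq_bigr => p _; rewrite eqF. Qed.

Lemma wsum_suml I (r : seq I) (P : pred I) (F : I -> K -> V) D :
  wsum (fun p => \sum_(i <- r | P i) F i p) D = \sum_(i <- r | P i) wsum (F i) D.
Proof.
by rewrite /wsum exchange_big; apply: eq_bigr => p _; rewrite mulrz_suml.
Qed.

Lemma wsumDl F1 F2 D : wsum (fun p => F1 p + F2 p) D = wsum F1 D + wsum F2 D.
Proof. by rewrite /wsum -big_split; apply: eq_bigr => p _; rewrite mulrzDl. Qed.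

Lemma wsum_local F D1 D2 :
  (forall p, coeff p D1 != coeff p D2 -> F p = 0) -> wsum F D1 = wsum F D2.
Proof.
move=> F0; apply/eqP; rewrite -subr_eq0 -wsumB; apply/eqP/big1_seq => p /= _.
rewrite coeffB; have [->|/F0->] := eqVneq (coeff p D1) (coeff p D2).
  by rewrite subrr mulr0z.
by rewrite mul0rz.
Qed.

End WeightedSum.

Section DegreeSum.
Variable K : choiceType.
Implicit Type D : {freeg K / int}.

Lemma wsum_deg D : wsum (fun=> 1) D = deg D.
Proof.
rewrite -[D in RHS]freeg_sumE (big_morph _ (@degD _) (@deg0 _)).
by apply: eq_bigr => p _; rewrite degU intz.
Qed.

Lemma wsum_coeff D q : wsum (fun p => (p == q)%:R : int) D = coeff q D.
Proof.
rewrite -[D in RHS]freeg_sumE (big_morph _ (coeffD q) (coeff0 _ q)).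
by apply: eq_bigr => p _; rewrite coeffU -mulrzr intz mulrC.
Qed.

Lemma wsum_ge0 (F : K -> int) D :
  (forall p, 0 <= F p) -> (forall p, 0 <= coeff p D) -> 0 <= wsum F D.
Proof.
by move=> F0 D0; apply: sumr_ge0 => p _; rewrite -mulrzr mulr_ge0 ?intz.
Qed.

Lemma wsum_mulz (V : zmodType) (a : V) (F : K -> int) D :
  wsum (fun p => a *~ F p) D = a *~ wsum F D.
Proof.
rewrite /wsum mulrz_sumr; apply: eq_bigr => p _.
by rewrite -mulrzA -mulrzr intz.
Qed.

Lemma wsum_mulr (R : comRingType) (a : R) (F : K -> R) D :
  wsum (fun p => a * F p) D = a * wsum F D.
Proof.
by rewrite /wsum mulr_sumr; apply: eq_bigr => p _; rewrite mulrzAr.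
Qed.

End DegreeSum.

(** * Piecewise affine functions *)

Section Hinges.
Variable R : realType.
Implicit Types (h : R -> R) (s : int) (hs : seq (int * R)) (L : R).

Definition has_slope h s : Prop :=
  exists2 eps : R, 0 < eps & forall u, 0 <= u <= eps -> h u = h 0 + s%:~R * u.

(** The initial slope is unique, so the choice made by [xget] in [slope] can only return it. *)
Lemma has_slope_slope h s : has_slope h s -> slope h = s.
Proof.
move=> hs; rewrite /slope; case: xgetP => [t _|/(_ s) //].
case: hs => [e e0 he] [e' e'0 he'].
have m0 : 0 < Num.min e e' by rewrite lt_min e0.
have := he (Num.min e e'); rewrite ge_min lexx (ltW m0) => /(_ isT) E.
have := he' (Num.min e e'); rewrite ge_min lexx orbT (ltW m0) E => /(_ isT).
by move/addrI/(mulIf (lt0r_neq0 m0))/intr_inj.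
Qed.

Lemma has_slope_ext h1 h2 s (d : R) : 0 < d ->
  (forall u, 0 <= u <= d -> h1 u = h2 u) -> has_slope h2 s -> has_slope h1 s.
Proof.
move=> d0 eqh [e e0 he]; exists (Num.min d e); first by rewrite lt_min d0.
move=> u /andP[u0]; rewrite le_min => /andP[ud ue].
by rewrite !eqh ?lexx ?u0 ?ud ?(ltW d0)// he // u0.
Qed.

Lemma has_slopeD h1 h2 s1 s2 : has_slope h1 s1 -> has_slope h2 s2 ->
  has_slope (fun u => h1 u + h2 u) (s1 + s2).
Proof.
move=> [d d0 hd] [e e0 he]; exists (Num.min d e); first by rewrite lt_min d0.
move=> u /andP[u0]; rewrite le_min => /andP[ud ue].
by rewrite hd ?u0 // he ?u0 // rmorphD /=; ring.
Qed.

Lemma has_slope_affine (a : R) s : has_slope (fun u => a + s%:~R * u) s.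
Proof. by exists 1 => // u _; rewrite mulr0 addr0. Qed.

(** An entry of [hs] is a slope jump paired with the place where it occurs. *)
Definition hinge hs (t : R) : R :=
  \sum_(z <- hs) z.1%:~R * Num.max 0 (t - z.2).

Lemma hinge_cons z hs t :
  hinge (z :: hs) t = z.1%:~R * Num.max 0 (t - z.2) + hinge hs t.
Proof. exact: big_cons. Qed.

Lemma hinge_rcons z hs t :
  hinge (rcons hs z) t = hinge hs t + z.1%:~R * Num.max 0 (t - z.2).
Proof. by rewrite /hinge -cats1 big_cat big_seq1. Qed.

Lemma hinge0 hs : all (fun z => 0 < z.2) hs -> hinge hs 0 = 0.
Proof.
move=> /allP h0; apply: big1_seq => z /= /h0 z0.
by rewrite max_l ?mulr0 // sub0r oppr_le0 ltW.
Qed.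

Lemma hinge_right hs L : all (fun z => z.2 <= L) hs ->
  hinge hs L = (\sum_(z <- hs) z.1)%:~R * L - \sum_(z <- hs) z.2 *~ z.1.
Proof.
elim: hs => [_|z hs IH /= /andP[zL /IH IHL]]; rewrite ?hinge_cons.
  by rewrite /hinge !big_nil mul0r subr0.
rewrite IHL !big_cons max_r ?subr_ge0 // rmorphD /= -[z.2 *~ _]mulrzr; ring.
Qed.

Lemma hinge_slope_right hs (x : R) :
  has_slope (fun u => hinge hs (x + u)) (\sum_(z <- hs | z.2 <= x) z.1).
Proof.
elim: hs => [|z hs IH].
  by rewrite big_nil; exists 1 => // u _; rewrite /hinge !big_nil mul0r addr0.
have -> : (fun u => hinge (z :: hs) (x + u)) =
    (fun u => z.1%:~R * Num.max 0 (x + u - z.2) + hinge hs (x + u)).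
  by apply: funext => u; rewrite hinge_cons.
rewrite big_cons; case: ifP => [zx|/negbT]; last rewrite -ltNge => zx.
  apply: has_slopeD IH; exists 1 => // u /andP[u0 _].
  rewrite addr0 !max_r; [by ring|by lra|by lra].
rewrite -[\sum_(_ <- _ | _) _]add0r; apply: has_slopeD IH; exists (z.2 - x).
  by rewrite subr_gt0.
move=> u /andP[u0 ux]; rewrite mul0r addr0 addr0 !max_l //; lra.
Qed.

Lemma hinge_slope_left hs (x : R) :
  has_slope (fun u => hinge hs (x - u)) (- \sum_(z <- hs | z.2 < x) z.1).
Proof.
elim: hs => [|z hs IH].
  by rewrite big_nil oppr0; exists 1 => // u _; rewrite /hinge !big_nil mul0r addr0.
have -> : (fun u => hinge (z :: hs) (x - u)) =
    (fun u => z.1%:~R * Num.max 0 (x - u - z.2) + hinge hs (x - u)).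
  by apply: funext => u; rewrite hinge_cons.
rewrite big_cons; case: ifP => [zx|/negbT]; last rewrite -leNgt => zx.
  rewrite opprD; apply: has_slopeD IH; exists (x - z.2).
    by rewrite subr_gt0.
  move=> u /andP[u0 ux]; rewrite subr0 !max_r; [|by lra|by lra].
  by rewrite rmorphN /=; ring.
rewrite -[- \sum_(_ <- _ | _) _]add0r; apply: has_slopeD IH; exists 1 => //.
move=> u /andP[u0 _]; rewrite mul0r addr0 subr0 !max_l //; lra.
Qed.

(** Induction on the pieces: passing to the next piece adds one hinge at the common end, weighted by
    the difference of the two slopes. *)
Lemma piecewise_affine_hinge L h : 0 < L -> piecewise_affine L h ->
  exists (s : int) hs, all (fun z => 0 < z.2 < L) hs /\
    forall x, 0 <= x <= L -> h x = h 0 + s%:~R * x + hinge hs x.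
Proof.
move=> L0 [n [t [s [t0 tn tS haff]]]].
have n0 : (0 < n)%N by case: n tn {tS haff} => // E; move: L0; rewrite -E t0 ltxx.
have tmono i j : (i < j <= n)%N -> t i < t j.
  case/andP; elim: j => // j IH; rewrite ltnS leq_eqVlt => /orP[/eqP->|ij] jn.
    exact: tS.
  exact: lt_trans (IH ij (ltnW jn)) (tS _ jn).
have t_ge0 i : (i <= n)%N -> 0 <= t i.
  by case: i => [|i] le_in; rewrite -t0 // ltW // tmono.
suff H i : (i < n)%N -> exists hs, [/\ all (fun z => 0 < z.2 < L) hs,
     all (fun z => z.2 <= t i) hs, (s 0%N + \sum_(z <- hs) z.1 = s i)
     & forall x, 0 <= x <= t i.+1 -> h x = h 0 + (s 0%N)%:~R * x + hinge hs x].
  have /H[hs [hsL _ _ hh]] : (n.-1 < n)%N by rewrite prednK.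
  by exists (s 0%N), hs; split=> //; move: hh; rewrite prednK // tn.
elim: i => [_|i IH lt_in].
  exists [::]; split; rewrite ?big_nil ?addr0 // => x.
  rewrite -{1}t0 => xt.
  by rewrite (haff 0%N) // t0 subr0 /hinge big_nil addr0.
case/(_ (ltnW lt_in)): IH => hs [hsL hsi hsum hh].
exists (rcons hs (s i.+1 - s i, t i.+1)); split.
- rewrite all_rcons /= hsL andbT -[X in X < _]t0 -tn !tmono //.
    by rewrite lt_in leqnn.
  by rewrite /= ltnW.
- rewrite all_rcons /= lexx /=; apply: sub_all hsi => z /= zi.
  by apply: le_trans zi _; rewrite ltW // tS // ltnW.
- by rewrite -cats1 big_cat big_seq1 /= -hsum; ring.
move=> x /andP[x0 xt]; rewrite hinge_rcons /=.
have [xi|/ltW xi] := leP x (t i.+1).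
  rewrite max_l ?mulr0 ?addr0; last by rewrite subr_le0.
  by apply: hh; rewrite x0.
rewrite (haff i.+1) ?xi // max_r ?subr_ge0 // hh ?lexx ?t_ge0 1?ltnW //.
have hsx (y : R) : t i <= y -> all (fun z => z.2 <= y) hs.
  by move=> iy; apply: sub_all hsi => z /= /le_trans->.
have ti : t i <= t i.+1 by rewrite ltW // tS // ltnW.
rewrite !hinge_right ?hsx // ?(le_trans ti) //.
have -> : s i.+1 = (s i.+1 - s i) + (s 0%N + \sum_(z <- hs) z.1).
  by rewrite hsum; ring.
rewrite !rmorphD /= rmorphN /= -hsum !rmorphD /=; ring.
Qed.

Lemma hinge_piecewise_affine L h (A : R) s hs :
  0 < L -> all (fun z => 0 < z.2 < L) hs ->
  (forall x, 0 <= x <= L -> h x = A + s%:~R * x + hinge hs x) ->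
  piecewise_affine L h.
Proof.
move=> L0 hsL hh.
(* Entries of [hs] may share a place, hence [undup]: the subdivision has to be strictly
   increasing. *)
pose ts := 0 :: rcons (sort <=%R (undup (map snd hs))) L.
have sts : sorted <%R ts.
  rewrite lt_sorted_uniq_le; apply/andP; split.
    rewrite /= mem_rcons rcons_uniq inE negb_or (lt_eqF L0) /= !mem_sort.
    rewrite sort_uniq undup_uniq !mem_undup andbT; apply/andP; split.
      by apply/mapP => -[z /(allP hsL)/andP[+ _] z0]; rewrite -z0 ltxx.
    by apply/mapP => -[z /(allP hsL)/andP[_ +] zL]; rewrite -zL ltxx.
  rewrite /= path_sortedE; last exact: le_trans.
  rewrite all_rcons (ltW L0) /=; apply/andP; split.
    apply/allP => x; rewrite mem_sort mem_undup => /mapP[z /(allP hsL)/andP[+ _]->].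
    exact: ltW.
  rewrite -cats1 (sorted_pairwise le_trans) pairwise_cat /= andbT.
  rewrite -(sorted_pairwise le_trans) sort_le_sorted andbT.
  rewrite allrel1r; apply/allP => x.
  rewrite mem_sort mem_undup => /mapP[z /(allP hsL)/andP[_ +]->].
  exact: ltW.
pose n := (size ts).-1.
have n0 : (0 < n)%N by rewrite /n /= size_rcons.
have sz : size ts = n.+1 by rewrite /n prednK.
have mt i : (i <= n)%N -> i \in [pred k | (k < size ts)%N] by rewrite inE sz ltnS.
have tlt i : (i < n)%N -> ts`_i < ts`_i.+1.
  move=> lt_in; rewrite (lt_sorted_ltn_nth 0 sts) ?mt //; exact: ltnW.
have ts_ge0 i : (i <= n)%N -> 0 <= ts`_i.
  move=> le_in; have -> : 0 = ts`_0 by [].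
  by rewrite (lt_sorted_leq_nth 0 sts) ?mt.
have tn : ts`_n = L by rewrite /n nth_last /= last_rcons.
have ts_leL i : (i <= n)%N -> ts`_i <= L.
  by move=> le_in; rewrite -tn (lt_sorted_leq_nth 0 sts) ?mt.
exists n, (fun i => ts`_i), (fun i => s + \sum_(z <- hs | z.2 <= ts`_i) z.1).
split=> // i x lt_in /andP[ix xi].
rewrite !hh ?(le_trans _ ix) ?(le_trans xi) ?ts_ge0 ?ts_leL ?(ltnW lt_in) //.
suff -> : hinge hs x =
    hinge hs ts`_i + (\sum_(z <- hs | z.2 <= ts`_i) z.1)%:~R * (x - ts`_i).
  by rewrite rmorphD /=; ring.
(* No hinge opens strictly inside a piece, so on that piece each hinge is either zero or affine. *)
have gap : all (fun z => (z.2 <= ts`_i) || (ts`_i.+1 <= z.2)) hs.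
  apply/allP => z zhs.
  have zts : z.2 \in ts.
    by rewrite inE mem_rcons inE mem_sort mem_undup map_f ?orbT.
  have jn : (index z.2 ts <= n)%N by rewrite -ltnS -sz index_mem.
  rewrite -(nth_index 0 zts); case: (leqP (index z.2 ts) i) => ij.
    by rewrite (lt_sorted_leq_nth 0 sts) ?mt ?ij // ltnW.
  by rewrite orbC (lt_sorted_leq_nth 0 sts) ?mt ?ij.
move: (ts`_i) (ts`_i.+1) ix xi gap => a b ax xb; clear -ax xb.
elim: hs => [|z hs IH].
  by rewrite /hinge !big_nil mul0r addr0.
move=> /= /andP[gz /IH]; rewrite !hinge_cons big_cons => ->.
case: ifP gz => [zi _|/negbT]; rewrite /= -?ltNge.
  by rewrite !max_r; [rewrite rmorphD /=; ring|lra|lra].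
by move=> zi iz; rewrite !max_l; [ring|lra|lra].
Qed.

End Hinges.

(** * Principal divisors *)

Section PrincipalDivisors.
Variables (R : realType) (G : metric_graph R).
Implicit Types (D : divisor G) (e : edge G) (p : point G) (t : R).

Definition on_edge e p : bool := if p is inr x then (val x).1 == e else false.
Definition offset p : R := if p is inr x then (val x).2 else 0.

Definition edge_deg e D : int := wsum (fun p => (on_edge e p)%:R) D.
Definition edge_moment e D : R := wsum (fun p => offset p * (on_edge e p)%:R) D.

Definition principal D : Prop :=
  exists2 f, rational_function f & forall p, coeff p D = div_coeff f p.

Lemma edge_pt_src e : edge_pt e 0 = inl (src e) :> point G.
Proof. by rewrite /edge_pt insubF /= ?ltxx ?lexx. Qed.

Lemma edge_pt_tgt e : edge_pt e (elen e) = inl (tgt e) :> point G.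
Proof.
by rewrite /edge_pt insubF /= ?ltxx ?andbF // leNgt elen_gt0.
Qed.

Lemma edge_ptE e t (te : 0 < (e, t).2 < elen (e, t).1) :
  edge_pt e t = inr (Sub (e, t) te) :> point G.
Proof. by rewrite /edge_pt insubT. Qed.

Lemma on_edge_pt e e' t : 0 < t < elen e -> on_edge e' (edge_pt e t) = (e == e').
Proof. by move=> te; rewrite edge_ptE /=. Qed.

Lemma offset_edge_pt e t : 0 < t < elen e -> offset (edge_pt e t) = t.
Proof. by move=> te; rewrite edge_ptE /=. Qed.

Lemma on_edgeE e p : on_edge e p -> 0 < offset p < elen e /\ p = edge_pt e (offset p).
Proof.
case: p => // -[[e' t] /= te] /eqP ee; case: _ / ee in te *.
by split=> //; rewrite edge_ptE; congr inr; apply: val_inj.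
Qed.

(** The coefficient at an interior point is the right slope minus the left slope, hence the total
    jump there. *)
Lemma edge_hinges (f : point G -> R) e (s : int) hs :
  let h t := f (edge_pt e t) in
  all (fun z => 0 < z.2 < elen e) hs ->
  (forall t, 0 <= t <= elen e -> h t = h 0 + s%:~R * t + hinge hs t) ->
  [/\ has_slope h s,
      has_slope (fun u => h (elen e - u)) (- (s + \sum_(z <- hs) z.1))
    & forall t, 0 < t < elen e ->
        div_coeff f (edge_pt e t) = \sum_(z <- hs | z.2 == t) z.1].
Proof.
move=> h hsL hh; have L0 := elen_gt0 e.
have rslope t : 0 <= t < elen e ->
    has_slope (fun u => h (t + u)) (s + \sum_(z <- hs | z.2 <= t) z.1).
  move=> /andP[t0 tL].
  apply: (@has_slope_ext _ _ (fun u => h 0 + s%:~R * t + s%:~R * u + hinge hs (t + u))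
            _ (elen e - t)); first by rewrite subr_gt0.
    by move=> u /andP[u0 uL]; rewrite hh; [ring|lra].
  exact/has_slopeD/hinge_slope_right/has_slope_affine.
have lslope t : 0 < t <= elen e ->
    has_slope (fun u => h (t - u)) (- (s + \sum_(z <- hs | z.2 < t) z.1)).
  move=> /andP[t0 tL].
  apply: (@has_slope_ext _ _ (fun u => h 0 + s%:~R * t + (- s)%:~R * u + hinge hs (t - u))
            _ t) => //.
    by move=> u /andP[u0 uL]; rewrite hh; [rewrite rmorphN /=; ring|lra].
  by rewrite opprD; exact/has_slopeD/hinge_slope_left/has_slope_affine.
split.
- have := rslope 0; rewrite lexx L0 => /(_ isT).
  have -> : (fun u => h (0 + u)) = h by apply: funext => u; rewrite add0r.
  rewrite big1_seq ?addr0 // => z /andP[z0 /(allP hsL)/andP[+ _]].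
  by move/(le_lt_trans z0); rewrite ltxx.
- have := lslope (elen e); rewrite lexx L0 => /(_ isT).
  rewrite [X in s + X]big_seq_cond; under eq_bigl => z.
    rewrite andbC; have -> : (z.2 < elen e) && (z \in hs) = (z \in hs).
      by case: (boolP (z \in hs)) => [/(allP hsL)/andP[_ ->]|]; rewrite ?andbF.
    over.
  by rewrite -big_seq.
move=> t te; rewrite edge_ptE /=.
case/andP: (te) => t0 tL.
rewrite (has_slope_slope (rslope t _)) ?(ltW t0) //.
rewrite (has_slope_slope (lslope t _)) ?t0 ?(ltW tL) //.
rewrite [X in s + X - _](bigID (fun z => z.2 < t)) /=.
rewrite (eq_bigl (fun z => z.2 < t)); last first.
  by move=> z; apply: andb_idl => /ltW.
rewrite [X in s + (_ + X)](eq_bigl (fun z => z.2 == t)); last first.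
  by move=> z; rewrite -leNgt eq_le.
by ring.
Qed.

Lemma edge_sums e D hs :
  all (fun z => 0 < z.2 < elen e) hs ->
  (forall t, 0 < t < elen e ->
     coeff (edge_pt e t) D = \sum_(z <- hs | z.2 == t) z.1) ->
  edge_deg e D = \sum_(z <- hs) z.1 /\
  edge_moment e D = \sum_(z <- hs) z.2 *~ z.1.
Proof.
move=> hsL hD; pose E : divisor G := \sum_(z <- hs) << z.1 *g edge_pt e z.2 >>.
have DE p : on_edge e p -> coeff p D = coeff p E.
  move=> /on_edgeE[te ->]; rewrite hD // (big_morph _ (coeffD _) (coeff0 _ _)).
  rewrite big_mkcond; apply: eq_big_seq => z /(allP hsL) ze.
  rewrite coeffU; have [->|zt] := eqVneq z.2; first by rewrite eqxx mulr1.
  case: eqP => [/(congr1 offset)|]; last by rewrite mulr0.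
  by rewrite !offset_edge_pt // => E'; rewrite E' eqxx in zt.
split.
  rewrite /edge_deg (wsum_local (D2 := E)) ?wsum_sum => [|p].
    apply: eq_big_seq => z /(allP hsL) ze.
    by rewrite wsumU on_edge_pt // eqxx intz.
  by case: (boolP (on_edge e p)) => // /DE ->; rewrite eqxx.
rewrite /edge_moment (wsum_local (D2 := E)) ?wsum_sum => [|p].
  apply: eq_big_seq => z /(allP hsL) ze.
  by rewrite wsumU on_edge_pt // eqxx mulr1 offset_edge_pt.
by case: (boolP (on_edge e p)) => [/DE ->|]; rewrite ?eqxx ?mulr0.
Qed.

(** Integration along an edge: a function with divisor [D] and initial slope [s e] arrives with
    slope [s e + edge_deg e D], and it rises by this final slope times the length minus the first
    moment of [D] on the edge. The existence of a function thus becomes a finite system of equations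
    at vertices and edges. *)
Lemma principalP D : principal D <->
  exists (s : edge G -> int) (phi : vertex G -> R),
    (forall v, coeff (inl v) D =
       \sum_(e | src e == v) s e - \sum_(e | tgt e == v) (s e + edge_deg e D)) /\
    (forall e, phi (tgt e) - phi (src e) =
       (s e + edge_deg e D)%:~R * elen e - edge_moment e D).
Proof.
split=> [[f frat fD]|[s [phi [sD phiD]]]].
  pose s e := slope (fun u => f (edge_pt e u)).
  have He e : [/\ slope (fun u => f (edge_pt e (elen e - u))) =
                    - (s e + edge_deg e D)
      & f (inl (tgt e)) - f (inl (src e)) =
         (s e + edge_deg e D)%:~R * elen e - edge_moment e D].
    have [s' [hs [hsL hh]]] := piecewise_affine_hinge (elen_gt0 e) (frat e).
    have [/has_slope_slope ss /has_slope_slope -> hsD] := edge_hinges hsL hh.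
    have [|-> ->] := edge_sums hsL (D := D).
      by move=> t te; rewrite fD hsD.
    rewrite /s ss; split=> //.
    have := hh (elen e); rewrite lexx ltW ?elen_gt0 // => /(_ isT).
    rewrite edge_pt_tgt edge_pt_src hinge_right => [->|].
      by rewrite rmorphD /=; ring.
    by apply: sub_all hsL => z /andP[_ /ltW].
  exists s, (fun v => f (inl v)); split=> [v|e]; last by have [] := He e.
  by rewrite fD /= -sumrN; congr (_ + _); apply: eq_bigr => e _; have [] := He e.
(* To recover the function, every point of [D] inside [e] bends it by its coefficient. *)
pose hs e := [seq (coeff p D, offset p) | p <- dom D & on_edge e p].
pose H e t := phi (src e) + (s e)%:~R * t + hinge (hs e) t.
pose f p := match p with
  | inl v => phi v
  | inr x => H (val x).1 (val x).2
  end.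
have hsL e : all (fun z => 0 < z.2 < elen e) (hs e).
  apply/allP => z /mapP[p]; rewrite mem_filter => /andP[/on_edgeE[pe _] _] ->.
  exact: pe.
have hsD e t : 0 < t < elen e ->
    coeff (edge_pt e t) D = \sum_(z <- hs e | z.2 == t) z.1.
  move=> te; rewrite big_map big_filter_cond -wsum_coeff /wsum [RHS]big_mkcond.
  apply: eq_bigr => p _; rewrite -mulrzr intz.
  suff -> : (p == edge_pt e t) = on_edge e p && (offset p == t).
    by case: ifP; rewrite ?mul1r ?mul0r.
  apply/eqP/andP => [->|[/on_edgeE[_ pE]/eqP pt]]; last by rewrite pE pt.
  by rewrite on_edge_pt // offset_edge_pt // !eqxx.
have hsum e := edge_sums (hsL e) (hsD e).
have H0 e : H e 0 = phi (src e).
  rewrite /H mulr0 addr0 hinge0 ?addr0 //.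
  by apply: sub_all (hsL e) => z /andP[].
have HL e : H e (elen e) = phi (tgt e).
  rewrite /H hinge_right; last by apply: sub_all (hsL e) => z /andP[_ /ltW].
  have [<- <-] := hsum e; apply/eqP; rewrite -subr_eq0.
  have := phiD e; rewrite rmorphD /= => E; apply/eqP.
  have -> : phi (tgt e) = phi (tgt e) - phi (src e) + phi (src e) by ring.
  by rewrite E; ring.
have fH e t : 0 <= t <= elen e -> f (edge_pt e t) = H e t.
  rewrite !le_eqVlt => /andP[/orP[/eqP<-|t0]]; first by rewrite edge_pt_src H0.
  case/orP=> [/eqP->|tL]; first by rewrite edge_pt_tgt HL.
  by rewrite edge_ptE ?t0.
have fhh e t : 0 <= t <= elen e -> f (edge_pt e t) =
    f (edge_pt e 0) + (s e)%:~R * t + hinge (hs e) t.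
  by move=> te; rewrite fH // fH ?lexx ?(ltW (elen_gt0 e)) // H0.
have Hs e := edge_hinges (hsL e) (fhh e).
exists f => [e|[v|x]].
- exact: hinge_piecewise_affine (elen_gt0 e) (hsL e) (fhh e).
- rewrite sD /= -sumrN; congr (_ + _); apply: eq_bigr => e _.
    by have [/has_slope_slope] := Hs e.
  by have [_ /has_slope_slope -> _] := Hs e; have [<- _] := hsum e.
have -> : inr x = edge_pt (val x).1 (val x).2 :> point G.
  by case: x => -[e t] /= te; rewrite edge_ptE; congr inr; apply: val_inj.
have xe : 0 < (val x).2 < elen (val x).1 by case: x.
by have [_ _ ->] := Hs (val x).1; rewrite ?hsD.
Qed.

Lemma lin_equivE D1 D2 : lin_equiv D1 D2 <-> principal (D1 - D2).
Proof. by []. Qed.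

End PrincipalDivisors.

(** * The genus *)

Section Genus.
Variables (R : realType) (G : metric_graph R).

Lemma boundary_kernel (c : 'rV[rat]_#|vertex G|) (x y : vertex G) :
  c *m (boundary G)^T = 0 -> c 0 (enum_rank x) = c 0 (enum_rank y).
Proof.
move=> cB.
have edgeP e : c 0 (enum_rank (src e)) = c 0 (enum_rank (tgt e)).
  move/matrixP: cB => /(_ 0 (enum_rank e)); rewrite !mxE.
  under eq_bigr => j _ do rewrite !mxE enum_rankK mulrBr.
  rewrite sumrB => /eqP; rewrite subr_eq0 => /eqP.
  have S v : \sum_(j < #|vertex G|) c 0 j * (v == enum_val j)%:R = c 0 (enum_rank v).
    rewrite (bigD1 (enum_rank v)) //= enum_rankK eqxx mulr1 big1 ?addr0 // => j.
    by rewrite -(inj_eq enum_val_inj) enum_rankK eq_sym => /negbTE->; rewrite mulr0.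
  by rewrite !S.
have /connectP[p] := vertex_connected x y.
elim: p x => [|z p IH] x /=; first by move=> _ ->.
case/andP=> /existsP[e exz] /IH{}IH /IH <-.
by case/orP: exz => /andP[/eqP<- /eqP<-]; rewrite edgeP.
Qed.

(** By connectedness the kernel of the transposed boundary map consists of the constant vectors. The
    boundary map thus has rank one less than the number of vertices, and rank-nullity gives Euler's
    formula. *)
Lemma genusE : (genus G + #|vertex G| = #|edge G| + 1)%N.
Proof.
have V0 := vertex_nonempty G.
suff rB : \rank (boundary G) = (#|vertex G| - 1)%N.
  have := mxrank_ker (boundary G); have := rank_leq_row (boundary G).
  by rewrite /genus rB => ? ->; lia.
pose J : 'rV[rat]_#|vertex G| := const_mx 1.
have JB : J *m (boundary G)^T = 0.
  apply/rowP => i; rewrite !mxE.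
  under eq_bigr => j _ do rewrite !mxE mul1r.
  have S v : \sum_(j < #|vertex G|) (v == enum_val j)%:R = 1 :> rat.
    rewrite (bigD1 (enum_rank v)) //= enum_rankK eqxx big1 ?addr0 // => j.
    by rewrite -(inj_eq enum_val_inj) enum_rankK eq_sym => /negbTE->.
  by rewrite sumrB !S subrr.
have kJ : (kermx (boundary G)^T :=: J)%MS.
  apply/eqmxP/andP; split; last exact/sub_kermxP.
  apply/row_subP => i.
  pose c := row i (kermx (boundary G)^T).
  have cB : c *m (boundary G)^T = 0 by rewrite -row_mul mulmx_ker row0.
  rewrite -/c (_ : c = c 0 (Ordinal V0) *: J) ?scalemx_sub //.
  apply/rowP => j; rewrite [in RHS]mxE [J _ _]mxE mulr1.
  by rewrite -(enum_valK j) -(enum_valK (Ordinal V0)); apply: boundary_kernel.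
have := mxrank_ker (boundary G)^T; rewrite kJ mxrank_tr rank_rV.
have -> : J != 0.
  apply/eqP => /rowP/(_ (Ordinal V0))/eqP; rewrite !mxE.
  by rewrite oner_eq0.
have := rank_leq_col (boundary G); lia.
Qed.

End Genus.

(** * Summation by parts against a principal divisor *)

Section Flow.
Variables (R : realType) (G : metric_graph R) (D : divisor G).
Variable s : edge G -> int.
Hypothesis sD : forall v, coeff (inl v) D =
  \sum_(e | src e == v) s e - \sum_(e | tgt e == v) (s e + edge_deg e D).

Lemma wsum_split (F : point G -> R) : wsum F D =
  \sum_v F (inl v) *~ coeff (inl v) D
  + \sum_e wsum (fun p => F p * (on_edge e p)%:R) D.
Proof.
have FE p : F p = \sum_(v : vertex G) F (inl v) * (p == inl v)%:R
                  + \sum_e F p * (on_edge e p)%:R.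
  rewrite -mulr_sumr; case: p => [v|x] /=.
    rewrite (big1 _ _ (fun e => (0 : R))) ?mulr0 ?addr0 //.
    rewrite (bigD1 v) //= eqxx mulr1 big1 ?addr0 // => u uv.
    case: eqP => [[vu]|_]; last by rewrite mulr0.
    by rewrite vu eqxx in uv.
  rewrite big1 ?add0r; last by move=> v _; rewrite mulr0.
  rewrite (bigD1 (val x).1) //= eqxx big1 ?addr0 ?mulr1 // => e xe.
  by rewrite eq_sym (negbTE xe).
rewrite (eq_wsum _ FE) wsumDl !wsum_suml; congr (_ + _).
apply: eq_bigr => v _; rewrite wsum_mulr -[coeff _ _]wsum_coeff -mulrzr.
congr (_ * _); rewrite /wsum rmorph_sum /=; apply: eq_bigr => p _.
by rewrite rmorphMz rmorph_nat.
Qed.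

(** [F] is affine from the source of each edge, but it may jump at the target. This happens for
    [coord] where a cycle closes up. *)
Lemma wsum_flow (F : point G -> R) (sigma : edge G -> R) :
  (forall e p, on_edge e p -> F p = F (inl (src e)) + sigma e * offset p) ->
  wsum F D = \sum_e ((s e + edge_deg e D)%:~R * (F (inl (src e)) - F (inl (tgt e)))
                     + sigma e * edge_moment e D).
Proof.
move=> Faff; rewrite wsum_split.
have -> : \sum_v F (inl v) *~ coeff (inl v) D =
    \sum_e (s e)%:~R * F (inl (src e))
    - \sum_e (s e + edge_deg e D)%:~R * F (inl (tgt e)).
  rewrite (partition_big (@src _ G) predT) //=.
  rewrite [X in _ - X](partition_big (@tgt _ G) predT) //=.
  rewrite -sumrB; apply: eq_bigr => v _.
  rewrite sD -mulrzr rmorphB !rmorph_sum mulrBr !mulr_sumr /=.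
  by congr (_ - _); apply: eq_bigr => e /eqP ->; rewrite mulrC.
rewrite -sumrB -big_split /=; apply: eq_bigr => e _.
have -> : wsum (fun p => F p * (on_edge e p)%:R) D =
    F (inl (src e)) * (edge_deg e D)%:~R + sigma e * edge_moment e D.
  rewrite mulrzr -wsum_mulz -wsum_mulr -wsumDl; apply: eq_wsum => p.
  case: (boolP (on_edge e p)) => [/Faff->|_]; last by rewrite !mulr0 addr0.
  by rewrite !mulr1.
by rewrite rmorphD /=; ring.
Qed.

Lemma flow_deg0 : deg D = 0.
Proof.
have H : wsum (fun=> 1 : R) D = 0.
  rewrite (wsum_flow (sigma := fun=> 0)) => [|*]; last by rewrite mul0r addr0.
  by rewrite big1 // => e _; rewrite subrr mulr0 mul0r addr0.
apply: (@intr_inj R); rewrite -wsum_deg -[RHS]H /wsum rmorph_sum /=.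
by apply: eq_bigr => p _; rewrite intz.
Qed.

End Flow.

(** * The Abel-Jacobi theorem for chains of cycles *)

Section ChainClasses.
Variables (R : realType) (g : nat) (C : chain_of_cycles R g).
Notation G := (chain_graph C).
Notation len i := (cyc_len C i.+1).
Notation arc i := (arc_len C i.+1).
Implicit Types (D : divisor G) (p : point G) (i : nat).

(* The points of the segment from [w_i] to [v_(i+1)] are counted with the
   cycle [i], onto which they retract at [w_i]. *)
Definition edge_home (e : edge G) : nat :=
  match e : chain_edge g with inl (j, _) => j | inr j => j end.

Definition home p : nat :=
  match p with
  | inl v => (v : chain_vertex g).1
  | inr x => edge_home (val x).1
  end.

Definition local_coord i p : R :=
  match p with
  | inl v => if (v : chain_vertex g).2 then arc i else 0
  | inr x => match (val x).1 : chain_edge g with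
    | inl (_, b) => if b then (val x).2 else arc i + (val x).2
    | inr _ => arc i
    end
  end.

(* The coordinate, counted from [v_i], of the image of [p] under the retraction
   of the chain onto its cycle [i] (counted from 0). *)
Definition coord i p : R :=
  if (home p < i)%N then 0 else if (i < home p)%N then arc i
  else local_coord i p.

(** Modulo the length of the cycle, this is one coordinate of the Abel-Jacobi map. *)
Definition class i D : R := wsum (coord i) D.

Lemma coord_affine i (e : edge G) p : on_edge e p ->
  coord i p = coord i (inl (src e)) +
    (if (e : chain_edge g) is inl (j, _) then (j == i :> nat)%:R else 0) * offset p.
Proof.
case: p => // x /eqP; rewrite /coord /=; move: (val x) => [e' t] /= ->.
case: e => [[j b]|j] /=; rewrite /edge_home /=.
  by case: ltngtP => _; rewrite ?mul0r ?addr0 //; case: b; rewrite /= mul1r ?add0r.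
by case: ltngtP => _; rewrite mul0r addr0.
Qed.

Lemma sum_edge (V : nmodType) (F : edge G -> V) :
  \sum_e F e = \sum_(j < g) (F (inl (j, true)) + F (inl (j, false)))
               + \sum_(j < g.-1) F (inr j).
Proof.
transitivity (\sum_(e : chain_edge g) F e); first by [].
rewrite big_sumType /=; congr (_ + _).
rewrite (eq_bigr (fun x => F (inl (x.1, x.2)))) => [|[]//].
rewrite -(pair_bigA _ (fun (j : 'I_g) (b : bool) => F (inl (j, b)))) /=.
by apply: eq_bigr => j _; rewrite big_bool.
Qed.

(** Only the two arcs of cycle [i] contribute, since [coord i] is constant along every other edge.
    The term with [len i] is the jump of the coordinate at [v]. If the rises come from a function,
    they cancel around the cycle and only this term is left. *)
Lemma class_flow i (i_lt : (i < g)%N) D (s : edge G -> int) :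
  (forall v, coeff (inl v) D =
    \sum_(e | src e == v) s e - \sum_(e | tgt e == v) (s e + edge_deg e D)) ->
  let s' e := s e + edge_deg e D in
  let rise e := (s' e)%:~R * elen e - edge_moment e D in
  let o := Ordinal i_lt in
  class i D = (s' (inl (o, false)))%:~R * len i
              - rise (inl (o, true)) - rise (inl (o, false)).
Proof.
move=> sD s' rise o; rewrite /class (wsum_flow sD (coord_affine i)).
pose sigma (e : edge G) : R :=
  if (e : chain_edge g) is inl (j, _) then (j == i :> nat)%:R else 0.
pose term e := (s' e)%:~R * (coord i (inl (src e)) - coord i (inl (tgt e)))
  + sigma e * edge_moment e D.
have term0 e : coord i (inl (src e)) = coord i (inl (tgt e)) -> sigma e = 0 -> term e = 0.
  by rewrite /term => -> ->; rewrite subrr mulr0 mul0r addr0.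
transitivity (\sum_e term e); first by [].
rewrite sum_edge (bigD1 o) //= big1 => [|j jo]; last first.
  have ji : (j == i :> nat) = false.
    by apply: contraNF jo => /eqP ji; apply/eqP/val_inj.
  rewrite !term0 ?addr0 //; rewrite /sigma ?ji // /coord /=;
    by move: ji; case: ltngtP.
rewrite big1 => [|j _]; last first.
  by apply: term0 => //; rewrite /coord /=; do 2?[case: ltngtP => ? //]; lia.
have cF : coord i (inl ((o, false) : vertex G)) = 0 by rewrite /coord /= ltnn.
have cT : coord i (inl ((o, true) : vertex G)) = arc i by rewrite /coord /= ltnn.
have -> : term (inl (o, true)) = (s' (inl (o, true)))%:~R * (0 - arc i)
    + 1 * edge_moment (inl (o, true) : edge G) D.
  by rewrite /term /sigma eqxx; congr (_ * (_ - _) + _).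
have -> : term (inl (o, false)) = (s' (inl (o, false)))%:~R * (arc i - 0)
    + 1 * edge_moment (inl (o, false) : edge G) D.
  by rewrite /term /sigma eqxx; congr (_ * (_ - _) + _).
rewrite /rise.
have -> : elen (inl (o, true) : edge G) = arc i by [].
have -> : elen (inl (o, false) : edge G) = len i - arc i by [].
move: (s' _) (s' _) (edge_moment _ _) (edge_moment _ _) => x y u v.
by rewrite !mul1r !sub0r subr0; ring.
Qed.

Lemma sum_src (V : nmodType) (F : edge G -> V) (v : vertex G) :
  \sum_(e | src e == v) F e =
  F (inl ((v : chain_vertex g).1, ~~ (v : chain_vertex g).2))
  + \sum_(j < g.-1 | (chain_this j, true) == (v : chain_vertex g)) F (inr j).
Proof.
case: v => i b; rewrite big_mkcond sum_edge -big_mkcond; congr (_ + _).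
rewrite (bigD1 i) //= big1 ?addr0 => [|j /negbTE ji].
  by rewrite !xpair_eqE eqxx; case: b; rewrite ?addr0 ?add0r.
by rewrite !xpair_eqE ji addr0.
Qed.

Lemma sum_tgt (V : nmodType) (F : edge G -> V) (v : vertex G) :
  \sum_(e | tgt e == v) F e =
  F (inl (v : chain_vertex g))
  + \sum_(j < g.-1 | (chain_next j, false) == (v : chain_vertex g)) F (inr j).
Proof.
case: v => i b; rewrite big_mkcond sum_edge -big_mkcond; congr (_ + _).
rewrite (bigD1 i) //= big1 ?addr0 => [|j /negbTE ji].
  by rewrite !xpair_eqE eqxx; case: b; rewrite ?addr0 ?add0r.
by rewrite !xpair_eqE ji addr0.
Qed.

Lemma home_lt p : (home p < g)%N.
Proof.
case: p => [[[i i_lt] b]//|x] /=; case: ((val x).1) => [[[i i_lt] b]//|[j /= jg]].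
by rewrite /edge_home /=; lia.
Qed.

Definition left_deg i D : int := wsum (fun p => (home p < i)%:R) D.

Lemma left_degS i (i_lt : (i < g)%N) D :
  let o := Ordinal i_lt in
  left_deg i.+1 D = left_deg i D
    + (coeff (inl (o, false) : point G) D + coeff (inl (o, true) : point G) D)
    + (edge_deg (inl (o, true) : edge G) D + edge_deg (inl (o, false) : edge G) D)
    + \sum_(j < g.-1 | chain_this j == o) edge_deg (inr j : edge G) D.
Proof.
move=> o; rewrite /left_deg -!wsum_coeff /edge_deg -wsum_suml -!wsumDl.
apply: eq_wsum => p; rewrite ltnS leq_eqVlt.
have -> : ((home p == i) || (home p < i)%N)%:R = (home p < i)%N%:R + (home p == i)%:R :> int.
  by case: ltngtP.
rewrite -!addrA; congr (_ + _); case: p => [[j b]|x] /=.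
  rewrite big1 // !addr0 !(inj_eq (@inl_inj _ _)) !xpair_eqE -!val_eqE /=.
  by case: eqP => //=; case: b.
move: (val x) => [[[j b]|j] t] /=; rewrite /edge_home /= ?add0r.
  rewrite big1 // !(inj_eq (@inl_inj _ _)) !xpair_eqE -!val_eqE /=.
  by case: eqP => //=; case: b.
case: eqP => ji; last first.
  rewrite big1 // => k /eqP/(congr1 val) /= ki; case: eqP => // -[jk].
  by rewrite jk ki in ji.
rewrite (bigD1 j) -?val_eqE /= ?ji //= eqxx big1 ?addr0 // => k /andP[_ /negbTE kj].
by case: eqP => // -[jk]; rewrite jk eqxx in kj.
Qed.

Lemma left_degg D : left_deg g D = deg D.
Proof. by rewrite -wsum_deg; apply: eq_wsum => p; rewrite home_lt. Qed.

Lemma left_deg0 D : left_deg 0 D = 0.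
Proof. by rewrite /left_deg; apply: big1 => p _; rewrite mul0rz. Qed.

Lemma sum_ord_ltS (V : nmodType) n (F : 'I_n -> V) (j : 'I_n) :
  \sum_(k : 'I_n | (k < j.+1)%N) F k = \sum_(k : 'I_n | (k < j)%N) F k + F j.
Proof.
rewrite (bigD1 j) //= addrC; congr (_ + _); apply: eq_bigl => k.
by rewrite ltnS -val_eqE ltn_neqAle andbC.
Qed.

Lemma principal_class D : principal D <->
  deg D = 0 /\ forall i, (i < g)%N -> exists z : int, class i D = z%:~R * len i.
Proof.
split=> [/principalP[s [phi [sD phiD]]]|[D0 Dcl]].
  split=> [|i i_lt]; first exact: flow_deg0 sD.
  rewrite (class_flow i_lt sD) -!phiD; eexists.
  by rewrite -addrA -opprD /= addrA subrK subrr subr0.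
have /choice[z zD] : forall i : 'I_g, exists z : int, class i D = z%:~R * len i.
  by move=> i; exact: Dcl.
(* The final slopes are dictated: [left_deg i.+1 D] on the segment leaving cycle [i], and [z i] on
   the arc returning to [v]. The slope on the other arc then follows from the equation at [v]. *)
pose s (e : edge G) : int := match e : chain_edge g with
  | inl (i, b) => if b then coeff (inl (i, false) : point G) D + z i + left_deg i D
                  else z i - edge_deg e D
  | inr i => left_deg i.+1 D - edge_deg e D
  end.
pose rise (e : edge G) : R := (s e + edge_deg e D)%:~R * elen e - edge_moment e D.
have sum_this (i : 'I_g) :
    \sum_(j < g.-1 | chain_this j == i) left_deg j.+1 D = left_deg i.+1 D.
  case: (ltnP i.+1 g) => ig.
    have ig' : (i < g.-1)%N by lia.
    rewrite (bigD1 (Ordinal ig')) /=; last by apply/eqP/val_inj.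
    rewrite big1 ?addr0 // => j /andP[/eqP ji]; case/eqP; apply: val_inj.
    by rewrite /= -ji.
  rewrite (_ : i.+1 = g) ?left_degg ?D0; last by move: (ltn_ord i) ig; lia.
  by rewrite big1 // => j /eqP ji; move: (ltn_ord j) ig; rewrite -ji /=; lia.
have sum_next (i : 'I_g) :
    \sum_(j < g.-1 | chain_next j == i) left_deg j.+1 D = left_deg i D.
  case: (posnP i) => [i0|i0].
    by rewrite i0 left_deg0 big1 // => j /eqP/(congr1 val) /=; rewrite i0.
  have ig' : (i.-1 < g.-1)%N by move: (ltn_ord i); lia.
  rewrite (bigD1 (Ordinal ig')) /=; last by apply/eqP/val_inj; rewrite /= prednK.
  rewrite prednK // big1 ?addr0 // => j /andP[/eqP ji]; case/eqP; apply: val_inj.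
  by rewrite /= -ji.
have sD (v : vertex G) : coeff (inl v) D =
    \sum_(e | src e == v) s e - \sum_(e | tgt e == v) (s e + edge_deg e D).
  rewrite sum_src sum_tgt; case: v => i b /=.
  rewrite [X in _ - (_ + X)](eq_bigr (fun j : 'I_g.-1 => left_deg j.+1 D)); last first.
    by move=> j _; rewrite /s subrK.
  have thisE c : \sum_(j < g.-1 | (chain_this j, true) == (i, c)) s (inr j) =
    if c then left_deg i.+1 D - \sum_(j < g.-1 | chain_this j == i) edge_deg (inr j : edge G) D
    else 0.
    case: c; last by rewrite big1 // => j /eqP[].
    rewrite -sum_this -sumrB; apply: eq_bigl => j.
    by rewrite xpair_eqE andbT.
  have nextE c : \sum_(j < g.-1 | (chain_next j, false) == (i, c)) left_deg j.+1 D =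
    if c then 0 else left_deg i D.
    case: c; first by rewrite big1 // => j /eqP[].
    by rewrite -sum_next; apply: eq_bigl => j; rewrite xpair_eqE andbT.
  rewrite thisE nextE; case: b; rewrite /= ?subrK; last first.
    move: (coeff (inl (i, false) : point G) D) (left_deg i D) (z i) => cF l y.
    by ring.
  have := left_degS (ltn_ord i) D; have -> : Ordinal (ltn_ord i) = i by apply: val_inj.
  move=> ->; rewrite /s.
  move: (coeff (inl (i, true) : point G) D) (coeff (inl (i, false) : point G) D).
  move: (edge_deg (inl (i, true) : edge G) D) (edge_deg (inl (i, false) : edge G) D).
  move: (left_deg i D) (\sum_(j < g.-1 | _) _) (z i) => l S y kT kF cT cF.
  by ring.
(* Here the condition on the classes enters: it makes the function single-valued around each
   cycle. *)
have riseP (i : 'I_g) : rise (inl (i, true)) + rise (inl (i, false)) = 0.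
  have := class_flow (ltn_ord i) sD; have -> : Ordinal (ltn_ord i) = i by apply: val_inj.
  rewrite -/(rise (inl (i, true))) -/(rise (inl (i, false))) zD /= subrK.
  move/eqP; rewrite -addrA -opprD -subr_eq0 subKr => /eqP E.
  by rewrite -[RHS]E /rise /s /= subrK.
(* [base n] is the value at [v] of cycle [n], obtained by adding the rises along the positive arcs
   and the segments to its left. *)
pose base n : R := \sum_(k < g | (k < n)%N) rise (inl (k, true))
                 + \sum_(k < g.-1 | (k < n)%N) rise (inr k).
pose phi (v : vertex G) : R :=
  base (v : chain_vertex g).1 + (if (v : chain_vertex g).2
                                 then rise (inl ((v : chain_vertex g).1, true)) else 0).
apply: (proj2 (principalP D)); exists s, phi; split=> // -[[i b]|i].
  rewrite -[RHS]/(rise (inl (i, b))) /phi /=; case: b => /=.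
    by rewrite addr0 addrC addKr.
  by rewrite addr0 opprD addrA subrr add0r; apply/eqP; rewrite eqr_oppLR -addr_eq0 riseP.
rewrite -[RHS]/(rise (inr i)) /phi /= /base addr0.
rewrite (sum_ord_ltS (fun k : 'I_g => rise (inl (k, true))) (chain_this i)).
rewrite (sum_ord_ltS (fun k : 'I_g.-1 => rise (inr k)) i).
move: (rise _) (rise _) (\sum_(_ < _ | _) _) (\sum_(_ < _ | _) _) => x y u v.
by ring.
Qed.

End ChainClasses.

(** * The particle process *)

Section Particles.
Variable fx : nat -> nat -> bool.
Implicit Types n q u : nat.

Fixpoint particle n q : nat :=
  if n is m.+1 then
    let u := particle m q in
    if fx m u && (if q is q'.+1 then particle m q' + 2 <= u else true)%N
    then u else u.+1
  else q.

(** The move of a particle that no neighbour blocks. *)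
Definition greedy n u : nat := if fx n u then u else u.+1.

Lemma greedy_le n u v : (u <= v)%N -> (greedy n u <= greedy n v)%N.
Proof.
rewrite leq_eqVlt => /predU1P[->//|uv]; rewrite /greedy.
by case: (fx n u); case: (fx n v); lia.
Qed.

Lemma greedy_bounds n u : (u <= greedy n u <= u.+1)%N.
Proof. by rewrite /greedy; case: (fx n u); lia. Qed.

Lemma particle_lt n q : (particle n q < particle n q.+1)%N.
Proof.
elim: n q => [//|n IH] q /=; have := IH q.
case: ifP => _; case: ifP => [/andP[_]|_]; case: q => [|q]; lia.
Qed.

Lemma particle_addn n q e : (particle n q + e <= particle n (q + e))%N.
Proof.
elim: e => [|e IH]; first by rewrite !addn0.
by rewrite !addnS; apply: leq_ltn_trans IH (particle_lt _ _).
Qed.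

Lemma particleS0 n : particle n.+1 0 = greedy n (particle n 0).
Proof. by rewrite /= andbT. Qed.

(** The two terms of the maximum are the options of an adversary who wants the particle far to the
    right: leave the cycle empty, or spend a chip on it and force a second one there. *)
Lemma particleSS n q : particle n.+1 q.+1 =
  maxn (greedy n (particle n q.+1)) (particle n q + 2).
Proof.
rewrite /= /greedy; have := particle_lt n q.
by case: (fx _ _) => /=; [case: ifP => H; lia | lia].
Qed.

Lemma particle_inj_le n q r : (particle n q <= particle n r)%N -> (q <= r)%N.
Proof.
move=> qr; rewrite leqNgt; apply/negP => rq.
by have := particle_addn n r (q - r); rewrite (subnKC (ltnW rq)); lia.
Qed.

End Particles.

Arguments particle : simpl never.

(** * The Young diagram of the delays *)

Section YoungDiagram.
Variable fx : nat -> nat -> bool.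
Notation M := (particle fx).
Implicit Types (n q x y m : nat).

(* After [n] steps particle [x] has been delayed [n + x - M n x] times.  These
   delays are the row lengths of a Young diagram, here given by its boxes. *)
Definition box n (b : nat * nat) : bool := (M n b.1 + b.2 < n + b.1)%N.

Lemma particle_step n q : (M n q <= M n.+1 q <= (M n q).+1)%N.
Proof. by rewrite /particle -/(particle fx); case: ifP => _; lia. Qed.

Lemma box0 b : box 0 b = false.
Proof. by rewrite /box /particle; lia. Qed.

Lemma boxS n b : box n b -> box n.+1 b.
Proof. by rewrite /box; have := particle_step n b.1; lia. Qed.

(** A particle stays only if the one behind leaves a gap. A new box is therefore an addable corner:
    its neighbours towards the origin are present before the step. *)
Lemma box_new n x y : box n.+1 (x, y) -> ~~ box n (x, y) ->
  [/\ (M n x + y = n + x)%N, fx n (M n x),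
      (0 < x)%N -> box n (x.-1, y) & (0 < y)%N -> box n (x, y.-1)].
Proof.
rewrite /box /= => b1 b0; have /andP[s1 s2] := particle_step n x.
have E : (M n x + y = n + x)%N by lia.
have : (M n.+1 x = M n x)%N by lia.
rewrite {1}/particle -/(particle fx); case: ifP => [/andP[fxu vac] _|_]; last by lia.
split=> //; last by lia.
by case: x vac E {b0 b1 s1 s2 fxu} => // x vac E _ /=; lia.
Qed.

(** * Growth of the diagram along a lattice path *)

Section Path.
Variables (path : nat -> nat * nat) (L : nat).
Hypothesis path_level : forall m, (m <= L)%N -> ((path m).1 + (path m).2 = m)%N.
Hypothesis path_step : forall m, (m < L)%N ->
  (path m.+1 = ((path m).1.+1, (path m).2)) \/ (path m.+1 = ((path m).1, (path m).2.+1)).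

(** The number of boxes of the path in the diagram, defined so that it visibly grows by at most one
    per step. *)
Fixpoint path_count n : nat :=
  if n is n'.+1 then
    (path_count n' + ((path_count n' <= L) && box n (path (path_count n'))))%N
  else 0%N.

(** By [box_new] the predecessor on the path of a new box was already present. So the boxes present
    form an initial part of the path, and only the first missing one can appear. *)
Lemma path_countP n m : (m <= L)%N -> box n (path m) = (m < path_count n)%N.
Proof.
elim: n m => [|n IH] m mL; first by rewrite box0.
set c := path_count n; rewrite /= -/c.
apply/idP/idP => [bm|].
  have [mc|cm] := ltnP m c; first by rewrite ltn_addr.
  have nb : ~~ box n (path m) by rewrite IH // -leqNgt.
  suff mE : m = c by rewrite -mE mL bm addn1.
  apply/eqP; rewrite eqn_leq cm andbT.
  case: m mL bm nb {cm} => // m mL bm nb; rewrite -IH 1?ltnW //.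
  have := path_step mL; case E: (path m.+1) bm nb => [x y] bm nb.
  have [_ _ bx by_] := box_new bm nb.
  case=> -[xE yE]; [have := bx|have := by_]; rewrite xE yE /= => /(_ isT);
    by case: (path m).
case: (boolP (_ && _)) => [/andP[cL bc]|_]; last by rewrite addn0 -IH // => /boxS.
by rewrite addn1 ltnS leq_eqVlt => /predU1P[->//|]; rewrite -IH // => /boxS.
Qed.

Lemma path_countS n : path_count n.+1 = path_count n \/
  [/\ path_count n.+1 = (path_count n).+1, (path_count n <= L)%N,
      box n.+1 (path (path_count n)) & ~~ box n (path (path_count n))].
Proof.
rewrite /=; case: (boolP (_ && _)) => [/andP[cL bc]|_]; last by left; rewrite addn0.
by right; split; rewrite ?addn1 // path_countP ?ltnn.
Qed.

End Path.

(** * The number of ordinary steps needed to fill a rectangle *)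

Section Rectangle.
Variables (g A B : nat) (special : pred nat).
Hypotheses (A1 : (1 < A)%N) (B1 : (1 < B)%N).
(** The bound [n.+1 < g] exempts the last step, which deals with the first cycle: the torsion
    profile starts with the second one. *)
Hypothesis fx_parity : forall n u v, (n.+1 < g)%N -> ~~ special n ->
  fx n u -> fx n v -> odd u = odd v.
Hypothesis fx_unique : forall n u v, (n.+1 < g)%N -> special n ->
  fx n u -> fx n v -> u = v.
Hypothesis special_range : forall n, special n -> (1 < n)%N /\ (n.+2 < g)%N.
Hypothesis special_gap : forall n, special n -> ~~ special n.+1.

Definition ordinary n : nat := \sum_(t < n) ~~ special t.

Lemma ordinaryS n : ordinary n.+1 = (ordinary n + ~~ special n)%N.
Proof. by rewrite /ordinary big_ord_recr. Qed.

Lemma ordinary_mono m n : (m <= n)%N -> (ordinary m <= ordinary n)%N.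
Proof.
elim: n => [|n IH]; first by rewrite leqn0 => /eqP->.
rewrite leq_eqVlt => /predU1P[->//|/IH]; rewrite ordinaryS; lia.
Qed.

Let L := (A + B - 2)%N.
(** Both paths lead from [(0, 0)] to the far corner [(A - 1, B - 1)] on level [L], and these two
    boxes are all that they share. *)
Let upper m := if (m < B)%N then (0, m)%N else (m - B + 1, B - 1)%N.
Let lower m := if (m < A)%N then (m, 0)%N else (A - 1, m - A + 1)%N.
Let p := path_count upper L.
Let q := path_count lower L.

Let upper_level m : (m <= L)%N -> ((upper m).1 + (upper m).2 = m)%N.
Proof. by rewrite /upper /L; case: ltnP => /=; lia. Qed.

Let lower_level m : (m <= L)%N -> ((lower m).1 + (lower m).2 = m)%N.
Proof. by rewrite /lower /L; case: ltnP => /=; lia. Qed.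

Let upper_step m : (m < L)%N ->
  upper m.+1 = ((upper m).1.+1, (upper m).2) \/ upper m.+1 = ((upper m).1, (upper m).2.+1).
Proof.
rewrite /upper /L => mL; case: (ltnP m.+1 B) => mB; first by rewrite ltnW //; right.
case: ltnP => mB' /=; left; congr (_, _); lia.
Qed.

Let lower_step m : (m < L)%N ->
  lower m.+1 = ((lower m).1.+1, (lower m).2) \/ lower m.+1 = ((lower m).1, (lower m).2.+1).
Proof.
rewrite /lower /L => mL; case: (ltnP m.+1 A) => mA; first by rewrite ltnW //; left.
case: ltnP => mA' /=; right; congr (_, _); lia.
Qed.

(** The position of the particle that stays fixes the parity of the level of the new box. At an
    ordinary step all new boxes thus lie on levels of one parity. *)
Let level_parity n x y : box n.+1 (x, y) -> ~~ box n (x, y) ->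
  odd (M n x) = odd (n + (x + y)).
Proof.
move=> b1 b0; have [E _ _ _] := box_new b1 b0.
have -> : (n + (x + y) = M n x + y.*2)%N by lia.
by rewrite oddD odd_double addbF.
Qed.

(* An ordinary step extends both paths only if their lengths have the same
   parity, and a special step extends only one of them. *)
Let path_bound n : (n < g)%N -> ~~ box n (A - 1, B - 1)%N ->
  (p n + q n <= (ordinary n).*2 + odd (p n + q n))%N /\
  (odd (p n + q n) -> (p n + q n < (ordinary n).*2)%N \/ ((0 < n)%N /\ special n.-1)).
Proof.
elim: n => [|n IH] ng nbox; first by split.
have [|IH1 IH2] := IH (ltnW ng); first by apply: contra nbox => /boxS.
(* Step 0 is ordinary. This covers a special step at which both lengths would grow from 0 to 1. *)
have ord1 : special n -> (0 < ordinary n)%N.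
  move=> /special_range[n1 _]; apply: leq_trans (ordinary_mono (ltnW n1)).
  by rewrite ordinaryS addnC; case: (boolP (special 0)) => [/special_range[]|].
have prev : (0 < n)%N -> special n.-1 -> ~~ special n.
  by case: (n) => // m _ /special_gap.
have same_parity : p n.+1 = (p n).+1 -> q n.+1 = (q n).+1 -> ~~ special n ->
    odd (p n + q n) = false.
  rewrite /p /q; case: (path_countS upper_step n) => [->|[_ pL b1 b0] _]; first by lia.
  case: (path_countS lower_step n) => [->|[_ qL c1 c0] _]; first by lia.
  move=> sn; move: (upper_level pL) (lower_level qL).
  rewrite -/(p n) -/(q n) in b1 b0 c1 c0 *.
  case: (upper (p n)) b1 b0 => x y b1 b0; case: (lower (q n)) c1 c0 => z t c1 c0 /= <- <-.
  have := fx_parity ng sn; have [_ fb _ _] := box_new b1 b0.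
  have [_ fc _ _] := box_new c1 c0 => /(_ _ _ fb fc).
  by rewrite (level_parity b1 b0) (level_parity c1 c0) !oddD => /addbI->; rewrite addbb.
(* At a special step all new boxes belong to one particle, so both paths gain the same box. The far
   corner being excluded, this is the common origin. *)
have both_special : p n.+1 = (p n).+1 -> q n.+1 = (q n).+1 -> special n ->
    p n = 0%N /\ q n = 0%N.
  rewrite /p /q; case: (path_countS upper_step n) => [->|[_ pL b1 b0] _]; first by lia.
  case: (path_countS lower_step n) => [->|[_ qL c1 c0] _]; first by lia.
  move=> sn; move: (upper_level pL) (lower_level qL).
  rewrite -/(p n) -/(q n) in b1 b0 c1 c0 pL qL *.
  have := fx_unique ng sn.
  case uE: (upper (p n)) b1 b0 => [x y] b1 b0; case lE: (lower (q n)) c1 c0 => [z t] c1 c0 /=.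
  have [xy fb _ _] := box_new b1 b0; have [zt fc _ _] := box_new c1 c0 => /(_ _ _ fb fc) E.
  have xz : x = z by apply/eqP; rewrite eqn_leq; apply/andP; split;
    apply: (@particle_inj_le fx n); rewrite E.
  subst z; have yt : y = t by move: xy zt; clear; lia.
  subst t => pE qE; have pq : p n = q n by rewrite -pE -qE.
  have : ~~ ((x == A - 1) && (y == B - 1))%N.
    by apply: contra nbox => /andP[/eqP<- /eqP<-].
  move: uE lE; rewrite -pq /upper /lower; clear -A1 B1.
  by do 2!(case: ltnP => ? -[? ?]); lia.
move: IH1 IH2 same_parity both_special; rewrite ordinaryS.
have pS : p n.+1 = p n \/ p n.+1 = (p n).+1.
  by rewrite /p; case: (path_countS upper_step n) => [|[]]; [left|right].
have qS : q n.+1 = q n \/ q n.+1 = (q n).+1.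
  by rewrite /q; case: (path_countS lower_step n) => [|[]]; [left|right].
move: (p n) (q n) (p n.+1) (q n.+1) pS qS => a b a' b' pS qS.
case: (boolP (special n)) => sn /= IH1 IH2 par both.
  have {}IH2 : odd (a + b) -> (a + b < (ordinary n).*2)%N.
    by move=> /IH2[//|[n0 /(prev n0)]]; rewrite sn.
  have {}both : a' = a.+1 -> b' = b.+1 -> a = 0%N /\ b = 0%N by move=> *; apply: both.
  split; last by move=> _; right.
  move: IH1 IH2 pS qS both (ord1 sn); rewrite addn0; clear; lia.
have {}par : a' = a.+1 -> b' = b.+1 -> odd (a + b) = false by move=> *; apply: par.
move: IH1 pS qS par; rewrite addn1; clear.
move=> IH pS qS par; split; first lia.
by move=> o; left; lia.
Qed.

(** Just before the far corner first appears, both of its neighbours are present, so each path has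
    at least [L] boxes and [path_bound] gives at least [L] ordinary steps so far. Step [g.-1] is
    ordinary and still to come, which supplies the last unit. *)
Lemma rectangle_bound : (M g (A - 1) + B <= g + (A - 1))%N ->
  (A + B - 1 <= ordinary g)%N.
Proof.
move=> Mg; pose corner n := box n (A - 1, B - 1)%N.
have ex : exists n, corner n by exists g; rewrite /corner /box /=; lia.
case: (ex_minnP ex) => -[|n]; first by rewrite /corner box0.
move=> cn nmin; have ng : (n < g)%N.
  by apply: nmin; rewrite /corner /box /=; lia.
have nc : ~~ corner n by apply/negP => /nmin; rewrite ltnn.
have [E _ bx by_] := box_new cn nc.
have uL : upper L.-1 = ((A - 1).-1, B - 1)%N.
  by rewrite /upper /L; case: ltnP => ? /=; congr (_, _); lia.
have lL : lower L.-1 = (A - 1, (B - 1).-1)%N.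
  by rewrite /lower /L; case: ltnP => ? /=; congr (_, _); lia.
have L0 : (0 < L)%N by rewrite /L; lia.
have pn : (L <= p n)%N.
  rewrite -(prednK L0) -(path_countP upper_step) ?leq_pred //.
  by rewrite uL; apply: bx; lia.
have qn : (L <= q n)%N.
  rewrite -(prednK L0) -(path_countP lower_step) ?leq_pred //.
  by rewrite lL; apply: by_; lia.
have [le_pq _] := path_bound ng nc.
have nsp : ~~ special g.-1.
  by apply/negP => /special_range[]; lia.
have : ordinary g = (ordinary g.-1).+1.
  by rewrite -{1}(prednK (leq_ltn_trans (leq0n _) ng)) ordinaryS nsp addn1.
have : (ordinary n <= ordinary g.-1)%N by apply: ordinary_mono; lia.
move: le_pq; rewrite /L in pn qn *; case: (odd _); lia.
Qed.

End Rectangle.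

(** * Processes with prescribed final positions *)

Lemma particle_move n q : ~~ fx n (M n q) -> M n.+1 q = (M n q).+1.
Proof. by rewrite {2}/particle -/(particle fx) => /negbTE->. Qed.

Lemma particle_fix n q : fx n (M n q) -> ((0 < q)%N -> M n q.-1 + 2 <= M n q)%N ->
  M n.+1 q = M n q.
Proof.
by rewrite {4}/particle -/(particle fx) => ->; case: q => //= q ->.
Qed.

Lemma particle_block n q : M n q.+1 = (M n q).+1 -> M n.+1 q.+1 = (M n q.+1).+1.
Proof.
rewrite {3}/particle -/(particle fx) => E; case: ifP => // /andP[_].
by rewrite E; lia.
Qed.

Lemma particle_free n0 n1 q : (n0 <= n1)%N ->
  (forall n u, (n0 <= n < n1)%N -> ~~ fx n u) -> M n1 q = (M n0 q + (n1 - n0))%N.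
Proof.
elim: n1 => [|n1 IH]; first by rewrite leqn0 => /eqP->; rewrite addn0.
rewrite leq_eqVlt => /predU1P[<- _|le_n free]; first by rewrite subnn addn0.
have E : M n1 q = (M n0 q + (n1 - n0))%N.
  by apply: IH => // n u /andP[n0n nn1]; apply: free; rewrite n0n ltnW.
rewrite particle_move E ?free ?le_n ?leqnn //; lia.
Qed.

Lemma particle_row g B : (B <= g)%N -> (forall n, (n < B)%N -> fx n 0) ->
  (forall n u, (B <= n < g)%N -> ~~ fx n u) -> M g 0 = (g - B)%N.
Proof.
move=> Bg row free; rewrite (particle_free _ Bg) //.
suff -> : M B 0 = 0%N by [].
elim: B row {Bg free} => // B IH row.
have M0 : M B 0 = 0%N by apply: IH => n nB; apply: row; exact: ltnW.
by rewrite particle_fix ?M0 // row.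
Qed.

(** The particles [0], ..., [r] are delayed once each, in turn. Before step [n], particle [n] stands
    undelayed at [n.*2], with a gap behind it because its predecessor was just delayed; the
    particles in front of it have no gap and are blocked. *)
Lemma particle_column g r : (r < g)%N -> (forall n, (n <= r)%N -> fx n n.*2) ->
  (forall n u, (r < n < g)%N -> ~~ fx n u) -> M g r = (g + r - 1)%N.
Proof.
move=> rg col free; rewrite (particle_free _ rg) //.
suff /(_ r (leqnn r))[_ ->] : forall n, (n <= r)%N ->
  (forall q, (n < q)%N -> M n.+1 q = (n.+1 + q)%N) /\ M n.+1 n = n.*2 by lia.
elim=> [_|n IH nr].
  by split=> [[|q] _ //|]; [rewrite particle_block | rewrite particle_fix // col].
have [IH1 IH2] := IH (ltnW nr); split=> [[//|q] nq|].
  by rewrite particle_block !IH1 //; lia.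
have E : M n.+1 n.+1 = n.+1.*2 by rewrite IH1 // addnn.
by rewrite particle_fix E ?col // => _; rewrite /= IH2; lia.
Qed.

(** Each of the first [K] ordinary steps before the last step fills an antidiagonal: the particles
    up to number [ordinary special n] stand on positions of one parity and all stay, while those
    beyond have no gap and are blocked. At the last step only particle [r] has to be controlled, so
    a single fixed position suffices there. *)
Lemma particle_staircase g r K (special : pred nat) :
  (r < K)%N -> (K <= ordinary special g)%N ->
  (forall n u, (n < g)%N -> special n || (K <= ordinary special n)%N -> ~~ fx n u) ->
  (forall n, (n < g)%N -> ~~ special n -> (ordinary special n < K)%N ->
     fx n (n + r.*2 - ordinary special n)%N) ->
  (forall n u, (n.+1 < g)%N -> ~~ special n -> (ordinary special n < K)%N ->
     odd u = odd (n + ordinary special n) -> fx n u) ->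
  M g r = (g + r - (K - r))%N.
Proof.
set N := ordinary special => rK Kg free last_fix fix_parity.
have Nn n : (N n <= n)%N by elim: n => [|n]; rewrite /N ?ordinaryS ?/ordinary ?big_ord0 //; lia.
(* The subtracted term is the delay of particle [q]; it drops by one from each particle to the
   next. *)
have stairs n : (n < g)%N -> forall q, M n q = (n + q - (minn (N n) K - q))%N.
  elim: n => [_ q|n IH ng q].
    by rewrite /N /ordinary big_ord0 min0n sub0n subn0.
  have {}IH := IH (ltnW ng).
  have [fr|] := boolP (special n || (K <= N n)%N).
    rewrite particle_move ?free ?(ltnW ng) // IH /N ordinaryS -/(N n).
    by have := Nn n; case/orP: fr => [->|] /=; lia.
  rewrite negb_or -ltnNge => /andP[sn NK].
  have NS : N n.+1 = (N n).+1 by rewrite /N ordinaryS sn addn1.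
  have := Nn n; have [qN|Nq] := leqP q (N n) => Nle.
    rewrite particle_fix ?IH ?NS; [lia| |by case: q qN => //= q; lia].
    apply: fix_parity => //; have -> : (n + q - (minn (N n) K - q) = n + q.*2 - N n)%N by lia.
    by rewrite oddB ?oddD ?odd_double; [case: odd; case: odd|lia].
  case: q Nq => // q Nq; rewrite particle_block !IH ?NS; lia.
case: g Kg last_fix free stairs {fix_parity} => [|g] Kg last_fix free stairs.
  by move: Kg; rewrite /N /ordinary big_ord0; lia.
have st := stairs g (ltnSn g); have NG := Nn g.
have [fr|] := boolP (special g || (K <= N g)%N).
  rewrite particle_move ?free // st; move: Kg; rewrite /N ordinaryS -/(N g).
  by case/orP: fr => [->|] /=; lia.
rewrite negb_or -ltnNge => /andP[sg NK].
have NE : N g = K.-1 by move: Kg; rewrite /N ordinaryS sg -/(N g); lia.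
rewrite particle_fix ?st; [lia| |by move: rK; case: (r) => //= q; lia].
have -> : (g + r - (minn (N g) K - r) = g + r.*2 - N g)%N by lia.
exact: last_fix.
Qed.

End YoungDiagram.

(** * The rank on a chain of cycles *)

Section ChainRank.
Variables (R : realType) (g : nat) (C : chain_of_cycles R g).
Notation G := (chain_graph C).
Notation len i := (cyc_len C i.+1).
Notation arc i := (arc_len C i.+1).
Implicit Types (D : divisor G) (p : point G) (i : nat).

Lemma len_gt0 i : (i < g)%N -> 0 < len i.
Proof. by move=> ig; have /andP[/lt_trans] := @arc_lenP _ _ C i.+1 ig; apply. Qed.

Lemma arc_bounds i : (i < g)%N -> 0 < arc i < len i.
Proof. by move=> ig; exact: (@arc_lenP _ _ C i.+1). Qed.

Lemma exists_cycle_point i (c : R) : (i < g)%N ->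
  exists2 p : point G, home p = i & exists z : int, coord i p = c + z%:~R * len i.
Proof.
move=> ig; have l0 := len_gt0 ig; have /andP[a0 al] := arc_bounds ig.
pose z := Num.floor (c / len i).
have /andP[zc cz] : z%:~R * len i <= c < (z + 1)%:~R * len i.
  by rewrite -ler_pdivlMr // -ltr_pdivrMr // floor_itv.
pose c' := c - z%:~R * len i.
have c'0 : 0 <= c' by rewrite subr_ge0.
have c'l : c' < len i by move: cz; rewrite /c' rmorphD /=; lra.
have c'E : c' = c + (- z)%:~R * len i by rewrite rmorphN mulNr.
suff [p hp cp] : exists2 p : point G, home p = i & coord i p = c'.
  by exists p => //; exists (- z); rewrite -c'E.
pose e b : edge G := inl (Ordinal ig, b).
have [ca|ac] := leP c' (arc i); last first.
  exists (edge_pt (e false) (c' - arc i)).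
    by rewrite edge_ptE //= subr_gt0 ac ltrD2r.
  by rewrite edge_ptE /= ?subr_gt0 ?ac ?ltrD2r // => H; rewrite /coord /= ltnn subrKC.
exists (edge_pt (e true) c').
  move: c'0 ca; rewrite le_eqVlt => /predU1P[<-|c0]; first by rewrite edge_pt_src.
  rewrite le_eqVlt => /predU1P[->|ca]; first by rewrite (edge_pt_tgt (e true)).
  by rewrite edge_ptE //= c0.
move: c'0 ca; rewrite le_eqVlt => /predU1P[<-|c0].
  by rewrite edge_pt_src /coord /= ltnn.
rewrite le_eqVlt => /predU1P[->|ca].
  by rewrite (edge_pt_tgt (e true)) /coord /= ltnn.
by rewrite edge_ptE /= ?c0 // => H; rewrite /coord /= ltnn.
Qed.

(** If a nonzero multiple [n] of the arc is a multiple of the length, half the length divided by [n]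
    works; otherwise half the length does. *)
Lemma exists_generic i : (i < g)%N ->
  exists delta : R, forall w z : int, delta <> w%:~R * arc i + z%:~R * len i.
Proof.
move=> ig; have l0 := len_gt0 ig.
have half (z : int) : (2%:R)^-1 * len i <> z%:~R * len i.
  move/(mulIf (lt0r_neq0 l0))/(congr1 (fun x => x * 2%:R)).
  rewrite mulVf ?pnatr_eq0 // -[2%:R]/(2%:~R) -rmorphM -[1]/(1%:~R).
  by move/intr_inj; lia.
have [[n [w [n0 nw]]]|irr] := pselect (exists n w : int, n != 0 /\ n%:~R * arc i = w%:~R * len i).
  exists ((2%:R)^-1 * len i / n%:~R) => w' z' E.
  have nR : n%:~R != 0 :> R by rewrite intr_eq0.
  apply: (@half (w' * w + z' * n)).
  rewrite rmorphD !rmorphM /= -[LHS](divfK nR) E mulrDl -!mulrA (mulrC (arc i)) nw.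
  by rewrite mulrCA mulrA; ring.
exists ((2%:R)^-1 * len i) => w z E; have [w0|w0] := eqVneq w 0.
  by move: E; rewrite w0 mul0r add0r; apply: half.
apply: irr; exists (2 * w), (1 - 2 * z); split; first lia.
have -> : (2 * w)%:~R * arc i = 2 * (w%:~R * arc i) by rewrite rmorphM mulrA.
have -> : w%:~R * arc i = (2%:R)^-1 * len i - z%:~R * len i by rewrite E; ring.
by rewrite rmorphB rmorphM /=; field.
Qed.

Definition eqmod i (x y : R) : Prop := exists z : int, x = y + z%:~R * len i.

Lemma eqmod_refl i x : eqmod i x x.
Proof. by exists 0; rewrite mul0r addr0. Qed.

Lemma eqmodD i x y x' y' : eqmod i x y -> eqmod i x' y' -> eqmod i (x + x') (y + y').
Proof. by move=> [z ->] [w ->]; exists (z + w); rewrite rmorphD /=; ring. Qed.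

Lemma eqmod_sym i x y : eqmod i x y -> eqmod i y x.
Proof. by move=> [z ->]; exists (- z); rewrite rmorphN /=; ring. Qed.

Lemma eqmod_trans i y x z : eqmod i x y -> eqmod i y z -> eqmod i x z.
Proof. by move=> [u ->] [v ->]; exists (u + v); rewrite rmorphD /=; ring. Qed.

Lemma classD i : {morph @class R g C i : D1 D2 / D1 + D2}.
Proof. exact: wsumD. Qed.

Lemma classB i : {morph @class R g C i : D1 D2 / D1 - D2}.
Proof. exact: wsumB. Qed.

Lemma classU i k p : class i << k *g p >> = k%:~R * coord i p.
Proof. by rewrite /class wsumU -mulrzr mulrC. Qed.

Lemma lin_equivP D1 D2 : lin_equiv D1 D2 <->
  deg D1 = deg D2 /\ forall i, (i < g)%N -> eqmod i (class i D1) (class i D2).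
Proof.
rewrite lin_equivE principal_class degB; split=> -[dE cE]; split.
- by apply/eqP; rewrite -subr_eq0 dE.
- by move=> i /cE[z]; rewrite classB => zE; exists z; rewrite -zE addrC subrK.
- by rewrite dE subrr.
by move=> i /cE[z zE]; exists z; rewrite classB zE addrC addKr.
Qed.

Definition right_deg i D : int := wsum (fun p => (i <= home p)%N%:R) D.

Lemma right_deg_ge0 i D : effective D -> 0 <= right_deg i D.
Proof. by move=> D0; apply: wsum_ge0. Qed.

Lemma right_deg0 D : right_deg 0 D = deg D.
Proof. by rewrite -wsum_deg; apply: eq_wsum. Qed.

Lemma right_degg D : right_deg g D = 0.
Proof.
by rewrite /right_deg; apply: big1 => p _; rewrite leqNgt home_lt mul0rz.
Qed.

Definition local_deg i D : int := wsum (fun p => (home p == i)%:R) D.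

Lemma right_degS i D : right_deg i D = right_deg i.+1 D + local_deg i D.
Proof.
rewrite /right_deg -wsumDl; apply: eq_wsum => p.
by case: ltngtP.
Qed.

Lemma local_deg_ge0 i D : effective D -> 0 <= local_deg i D.
Proof. by move=> D0; apply: wsum_ge0. Qed.

(** For an effective divisor, local degree zero means that no chip is at home on cycle [i]. All
    chips then retract to [v] or [w], and only those further right contribute. *)
Lemma class_local0 i D : effective D -> local_deg i D = 0 ->
  class i D = (right_deg i.+1 D)%:~R * arc i.
Proof.
move=> D0 /eqP; rewrite /local_deg /wsum psumr_eq0 => [/allP Di|p _]; last first.
  by rewrite -mulrzr mulr_ge0 ?intz ?D0.
rewrite mulrzl -wsum_mulz; apply: eq_big_seq => p /Di /=.
rewrite /coord eq_sym; case: ltngtP => // ip.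
rewrite intz => /eqP <-.
by rewrite !mulr0z.
Qed.

Definition cycle_point_spec i (c : R) p :=
  [/\ home p = i, eqmod i (coord i p) c,
      forall i', (i' < i)%N -> coord i' p = arc i'
    & forall i', (i < i')%N -> coord i' p = 0].

Lemma cycle_pointP i c : (i < g)%N -> exists p, cycle_point_spec i c p.
Proof.
move=> ig; have [p hp [z zE]] := exists_cycle_point c ig.
exists p; split=> //; first by exists z.
  by move=> i' ii; rewrite /coord hp ltnNge (ltnW ii) /= ii.
by move=> i' ii; rewrite /coord hp ii.
Qed.

Lemma effectiveD D1 D2 : effective D1 -> effective D2 -> effective (D1 + D2).
Proof. by move=> D10 D20 p; rewrite coeffD addr_ge0. Qed.

Lemma effectiveU (k : nat) p : effective (<< k%:Z *g p >> : divisor G).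
Proof. by move=> q; rewrite coeffU mulr_ge0. Qed.

(** * The rank read off from the final positions of the particles *)

Section Rank.
Variable D : divisor G.

(** If [u] chips lie to the right of the cycle treated at step [n], they alone already produce the
    class of [D] there, so the cycle can stay empty. *)
Definition fixes n (u : nat) : bool :=
  `[< eqmod (g - n.+1) (class (g - n.+1) D) (u%:R * arc (g - n.+1)) >].

Notation M := (particle fixes).

(* The complement of [E] is built from right to left: the next cycle gets no
   chip if the class of [D] permits, and otherwise a single chip, which is
   placed so as to realize any prescribed class. *)
Lemma complement_effective (E : divisor G) n : effective E -> (n <= g)%N ->
  exists F : divisor G, [/\ effective F,
    forall i, (i < g - n)%N -> class i F = (deg F)%:~R * arc i,
    forall i, (g - n <= i < g)%N -> eqmod i (class i F) (class i D - class i E)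
    & deg F + right_deg (g - n) E <= (M n `|right_deg (g - n) E|%N)%:Z].
Proof.
move=> E0; elim: n => [_|n IH ng].
  exists 0; split; rewrite ?deg0 ?subn0 ?right_degg //.
  - by move=> p; rewrite coeff0.
  - by move=> i _; rewrite /class wsum0 mul0r.
  by move=> i /andP[gi ig]; move: (leq_trans ig gi); rewrite ltnn.
have [F [F0 Fl Fr FE]] := IH (ltnW ng).
pose i := (g - n.+1)%N; have iE : (g - n = i.+1)%N by rewrite /i; lia.
have ig : (i < g)%N by rewrite /i; lia.
rewrite -/i; rewrite iE in Fl Fr FE.
have := right_degS i E; have := right_deg_ge0 i.+1 E0; have := local_deg_ge0 i E0.
have Fdeg : 0 <= deg F by rewrite -right_deg0 right_deg_ge0.
move: (@class_local0 i _ E0).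
case: (right_deg i.+1 E) FE => // q FE; case: (local_deg i E) => // e cE _ _ ->.
case dF: (deg F) Fdeg Fl FE => [f|//] _ Fl FE; rewrite -PoszD absz_nat in FE *.
have [/andP[/eqP e0 fxu]|add] := boolP ((e == 0%N) && fixes n (f + q)).
  subst e; move: fxu (cE erefl) => /asboolP fxu {}cE; rewrite -/i in fxu.
  exists F; split=> [//|i' ii|i' /andP[]|].
  - by rewrite dF; apply: Fl; exact: ltnW.
  - rewrite leq_eqVlt => /predU1P[<- _|ii i'g]; last first.
      by apply: Fr; rewrite ii.
    rewrite (Fl i) // cE; apply: eqmod_sym.
    have -> : f%:~R * arc i = (f + q)%N%:R * arc i - q%:~R * arc i.
      by rewrite natrD; ring.
    exact: eqmodD fxu (eqmod_refl _ _).
  rewrite dF -PoszD addn0; move: FE; rewrite !lez_nat => FE.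
  apply: (@leq_trans (greedy fixes n (M n q))).
    have fx' : fixes n (f + q) by apply/asboolP.
    by have := greedy_le fixes n FE; rewrite {1}/greedy fx'.
  by case: (q) => [|q']; rewrite ?particleS0 // particleSS leq_maxl.
have [p [hp pc pl pr]] := cycle_pointP (class i D - class i E - f%:~R * arc i) ig.
exists (F + << p >>); split.
- exact/effectiveD/effectiveU.
- move=> i' ii; rewrite classD classU pl // degD degU dF Fl; last exact: ltnW.
  by rewrite rmorphD mulrDl.
- move=> i' /andP[]; rewrite classD classU mul1r.
  rewrite leq_eqVlt => /predU1P[<- _|ii i'g].
    have := eqmodD (eqmod_refl i (class i F)) pc.
    by rewrite (Fl i) // [X in eqmod _ _ X]addrC subrK.
  by rewrite pr // addr0; apply: Fr; rewrite ii.
rewrite degD degU dF -!PoszD; move: FE add; rewrite !lez_nat => FE.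
(* If [E] has chips here, the term [particle n q + 2] of [particleSS] pays for one of them and for
   the new chip of [F]; [particle_addn] pays for the others. *)
case: (posnP e) => [->|e_gt0] /= add; last first.
  have := particle_addn fixes n q e.-1.
  case: (e) e_gt0 => // e' _ /=; rewrite !addnS particleSS; lia.
rewrite addn0; apply: (@leq_trans (greedy fixes n (M n q))).
  apply: leq_trans (greedy_le _ _ FE); rewrite /greedy (negbTE add).
  by rewrite -addnA addnCA.
by case: (q) => [|q']; rewrite ?particleS0 // particleSS leq_maxl.
Qed.

Lemma rank_ge (r : nat) : (M g r)%:Z <= deg D -> rank_at_least D r.
Proof.
move=> MD E E0 Er.
have [F [F0 _ Fc]] := complement_effective E0 (leqnn g).
rewrite subnn right_deg0 Er absz_nat => /le_trans/(_ MD) FD.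
have g0 := chain_genus_gt0 C.
(* A chip at the first [v] has coordinate 0 on every cycle, so it adjusts the degree without
   changing the classes. *)
pose v0 : point G := inl (Ordinal g0, false).
have v0c i : coord i v0 = 0.
  by rewrite /coord /=; case: ltngtP.
have [k kE] : exists k : nat, deg D - r%:Z - deg F = k%:Z.
  by exists (absz (deg D - r%:Z - deg F)%R); rewrite gez0_abs //; lia.
pose F' := F + << k%:Z *g v0 >>.
have F'0 : effective F' by apply/effectiveD/effectiveU.
exists (F' + E); split; first exact: effectiveD.
- apply/lin_equivP; split; first by rewrite !degD degU Er; lia.
  move=> i ig; rewrite !classD classU v0c mulr0 addr0.
  have /Fc : (g - g <= i < g)%N by rewrite subnn.
  by move/(@eqmodD i _ _ _ _)/(_ (eqmod_refl i (class i E))); rewrite subrK.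
by rewrite addrK.
Qed.

(* The adversary [E] puts a generic chip on a cycle whenever this gains more
   than leaving the cycle empty; the class on that cycle then forces every
   complement of [E] to have a chip there as well. *)
Lemma generic_effective n (q : nat) : (n <= g)%N ->
  exists E : divisor G, [/\ effective E, deg E = q%:Z,
    forall i, (i < g - n)%N -> class i E = q%:R * arc i
    & forall F : divisor G, effective F ->
        (forall i, (g - n <= i < g)%N -> eqmod i (class i F) (class i D - class i E)) ->
        (M n q)%:Z <= right_deg (g - n) F + q%:Z].
Proof.
elim: n q => [|n IH] q ng.
  have g0 := chain_genus_gt0 C.
  have gg : (g.-1 < g)%N by rewrite prednK.
  pose w : point G := inl (Ordinal gg, true).
  exists << q%:Z *g w >>; split.
  - exact: effectiveU.
  - by rewrite degU.
  - move=> i; rewrite subn0 classU => ig.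
    rewrite /coord /=; case: ltngtP => //=; lia.
  by move=> F F0 _ /=; rewrite subn0 right_degg add0r.
pose i := (g - n.+1)%N; have iE : (g - n = i.+1)%N by rewrite /i; lia.
have ig : (i < g)%N by rewrite /i; lia.
rewrite -/i iE in IH *.
(* The option of leaving the cycle empty: if [F] has no chip there either, the classes force the
   number of chips to the right to be a fixed position, and monotonicity of [greedy] concludes. *)
have stay q0 : M n.+1 q0 = greedy fixes n (M n q0) ->
    exists E : divisor G, [/\ effective E, deg E = q0%:Z,
    forall j, (j < i)%N -> class j E = q0%:R * arc j
    & forall F : divisor G, effective F ->
        (forall j, (i <= j < g)%N -> eqmod j (class j F) (class j D - class j E)) ->
        (M n.+1 q0)%:Z <= right_deg i F + q0%:Z].
  move=> ->; have [E [E0 Eq El EF]] := IH q0 (ltnW ng).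
  exists E; split=> // [j ji|F F0 Fc]; first by apply: El; exact: ltnW.
  have {}EF : (M n q0)%:Z <= right_deg i.+1 F + q0.
    by apply: EF => // j /andP[ij jg]; apply: Fc; rewrite jg andbT ltnW.
  have /andP[_ gb] := greedy_bounds fixes n (M n q0).
  rewrite right_degS; move: EF (@class_local0 i _ F0).
  move: (local_deg_ge0 i F0) (right_deg_ge0 i.+1 F0).
  case: (local_deg i F) => // -[|l] _; last by move=> ? ? _; lia.
  case: (right_deg i.+1 F) => // v _ EF /(_ erefl) cF.
  move: EF; rewrite addr0 -PoszD !lez_nat => le_v.
  have fv : fixes n (v + q0).
    apply/asboolP; rewrite -/i.
    have := eqmodD (Fc i _) (eqmod_refl i (class i E)).
    rewrite leqnn ig subrK cF El // => /(_ isT)/eqmod_sym.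
    by rewrite natrD mulrDl.
  by have := greedy_le fixes n le_v; rewrite {2}/greedy fv.
have [sE|] := eqVneq (M n.+1 q) (greedy fixes n (M n q)); first exact: stay.
case: q => [|q]; first by rewrite particleS0 eqxx.
(* The remaining option reaches [particle n q + 2]: one unit for the generic chip of [E], one for
   the chip that it forces in [F]. *)
rewrite particleSS; case: leqP => [le2 _|]; last by rewrite eqxx.
have [E [E0 Eq El EF]] := IH q (ltnW ng).
have [delta dP] := exists_generic ig.
have [p [hp pc pl pr]] := cycle_pointP (class i D + delta) ig.
exists (E + << p >>); split.
- exact/effectiveD/effectiveU.
- by rewrite degD degU Eq -PoszD addn1.
- move=> j ji; rewrite classD classU pl // El; last exact: ltnW.
  by rewrite -natr1 mulrDl.
move=> F F0 Fc.
have {}EF : (M n q)%:Z <= right_deg i.+1 F + q.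
  apply: EF => // j /andP[ij jg]; have := Fc j.
  by rewrite classD classU pr // mulr0 addr0 jg andbT; apply; exact: ltnW.
rewrite right_degS; have := @class_local0 i _ F0; have := local_deg_ge0 i F0.
case: (local_deg i F) => // -[|l] _; last by move=> _; lia.
move=> /(_ erefl) cF; exfalso.
have [z zE] : eqmod i delta (- ((right_deg i.+1 F)%:~R + q%:R) * arc i).
  have := Fc i; rewrite leqnn ig => /(_ isT); rewrite classD classU mul1r cF El //.
  case: pc => z1 pE [z2 FE]; exists (z2 - z1).
  have -> : delta = coord i p - class i D - z1%:~R * len i by rewrite pE; ring.
  rewrite mulNr mulrDl FE rmorphB /=; ring.
apply: (dP (- (right_deg i.+1 F + q%:Z)) z).
by rewrite zE rmorphN rmorphD.
Qed.

Lemma rank_le (r : nat) : rank_at_least D r -> (M g r)%:Z <= deg D.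
Proof.
have [E [E0 Er _ EF]] := generic_effective r (leqnn g).
move=> /(_ E E0 Er)[D' [_ /lin_equivP[dD cD] F0]].
have := EF _ F0; rewrite subnn right_deg0 degB dD Er subrK; apply.
move=> i /andP[_ ig]; rewrite classB.
exact/(eqmodD (cD i ig))/eqmod_refl.
Qed.

End Rank.

(** * Divisors with prescribed degree and classes *)

Lemma exists_class (d : int) (c : nat -> R) :
  exists2 D : divisor G, deg D = d & forall i, (i < g)%N -> eqmod i (class i D) (c i).
Proof.
suff [E Ec] : exists E : divisor G, forall i, (i < g)%N -> eqmod i (class i E) (c i).
  pose v0 : point G := inl (Ordinal (chain_genus_gt0 C), false).
  exists (E + << d - deg E *g v0 >>); first by rewrite degD degU subrKC.
  move=> i ig; rewrite classD classU (_ : coord i v0 = 0) ?mulr0 ?addr0; first exact: Ec.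
  by rewrite /coord /=; case: ltngtP.
suff /(_ g (leqnn g))[E [_ Ec]] : forall n, (n <= g)%N -> exists E : divisor G,
    (forall i, (i < g - n)%N -> class i E = (deg E)%:~R * arc i) /\
    (forall i, (g - n <= i < g)%N -> eqmod i (class i E) (c i)).
  by exists E => i ig; apply: Ec; rewrite subnn.
elim=> [_|n IH ng].
  exists 0; split=> [i _|i /andP[gi ig]]; first by rewrite /class wsum0 deg0 mul0r.
  by move: gi; rewrite subn0 leqNgt ig.
have [E [El Er]] := IH (ltnW ng).
pose i := (g - n.+1)%N; have iE : (g - n = i.+1)%N by rewrite /i; lia.
have ig : (i < g)%N by rewrite /i; lia.
rewrite -/i; rewrite iE in El Er.
have [p [_ pc pl pr]] := cycle_pointP (c i - (deg E)%:~R * arc i) ig.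
exists (E + << p >>); split=> j.
  move=> ji; rewrite classD classU pl // degD degU El; last exact: ltnW.
  by rewrite rmorphD mulrDl.
case/andP; rewrite classD classU mul1r leq_eqVlt => /predU1P[<- _|ij jg].
  by have := eqmodD (eqmod_refl i (class i E)) pc; rewrite El // [X in eqmod _ _ X]addrC subrK.
by rewrite pr // addr0; apply: Er; rewrite ij.
Qed.

(** [None] stands for a generic class, one that is no integral multiple of the arc modulo the
    length. *)
Lemma exists_prescribed (d : int) (target : nat -> option nat) :
  exists2 D : divisor G, deg D = d & forall n u, (n < g)%N ->
    if target n is Some u0
    then eqmod (g - n.+1) (u0%:R * arc (g - n.+1)) (u%:R * arc (g - n.+1)) -> fixes D n u
    else ~~ fixes D n u.
Proof.
have /choice[delta dP] : forall i : nat, exists delta : R,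
    (i < g)%N -> forall w z : int, delta <> w%:~R * arc i + z%:~R * len i.
  move=> i; case: (ltnP i g) => [/exists_generic[delta ?]|_]; first by exists delta.
  by exists 0.
have [D Dd Dc] := exists_class d (fun i => if target (g - i.+1)%N is Some u0
  then u0%:R * arc i else delta i).
exists D => // n u ng; have ig : (g - n.+1 < g)%N by lia.
have := Dc _ ig; rewrite (_ : g - (g - n.+1).+1 = n)%N; last lia.
case: (target n) => [u0 cD uu|cD]; first by apply/asboolP; exact: eqmod_trans cD uu.
apply/asboolPn => /(eqmod_trans (eqmod_sym cD))[z].
exact: (dP _ ig u%:Z z).
Qed.

(** Final positions increase strictly with the particle, so every particle beyond [r] ends beyond
    the degree. *)
Lemma has_rank_exact D (r : nat) :
  (particle (fixes D) g r)%:Z = deg D -> has_rank D r%:Z.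
Proof.
move=> MD; have rD : rank_at_least D r by apply: rank_ge; rewrite MD.
right; split.
  pose v0 : point G := inl (Ordinal (chain_genus_gt0 C), false).
  have [D' [D'0 /lin_equivP[dE cE] _]] := rD _ (effectiveU r v0) (degU _ _).
  by exists D' => //; apply/lin_equivP; split=> // i ig; apply/eqmod_sym/cE.
exists r; split=> // m /rank_le; rewrite -MD lez_nat; exact: particle_inj_le.
Qed.

Lemma has_rank_ge D (r : nat) : has_rank D r%:Z -> (particle (fixes D) g r)%:Z <= deg D.
Proof. by case=> [[]//|[_ [n [[->] rD _]]]]; exact: rank_le. Qed.

Lemma genus_chain : genus G = g.
Proof.
have := genusE G; have g0 := chain_genus_gt0 C.
have -> : #|vertex G| = (g * 2)%N by rewrite card_prod card_ord card_bool.
have -> : #|edge G| = (g * 2 + g.-1)%N.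
  by rewrite card_sum card_prod !card_ord card_bool.
lia.
Qed.

(** * Torsion as a relation between arc and length *)

Lemma torsion2 i : (i < g)%N -> torsion C i.+1 = 2%N -> 2%:R * arc i = len i.
Proof.
move=> ig; rewrite /torsion; case: ifP => // _.
case: xgetP => [m -> [[_ [z zE]] _]|//] m2; rewrite m2 in zE.
have /andP[a0 al] := arc_bounds ig; have l0 := len_gt0 ig.
rewrite zE; suff -> : z = 1 by rewrite mul1r.
have z0 : 0 < z%:~R :> R by rewrite -(pmulr_lgt0 _ l0) -zE mulr_gt0.
have z2 : z%:~R < 2%:R :> R by rewrite -(ltr_pM2r l0) -zE ltr_pM2l.
by move: z0 z2; rewrite ltr0z -[2%:R]/(2%:~R) ltr_int; lia.
Qed.

(** The value 0 is also the default of [xget], but for a rational ratio the minimum exists and is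
    positive. Hence torsion 0 excludes every nontrivial relation. *)
Lemma torsion0 i : (i < g)%N -> torsion C i.+1 = 0%N ->
  forall n z : int, n%:~R * arc i = z%:~R * len i -> n = 0.
Proof.
move=> ig tor n z E; have /andP[a0 al] := arc_bounds ig; have l0 := len_gt0 ig.
apply/eqP/negPn/negP => n0; have nR : n%:~R != 0 :> R by rewrite intr_eq0.
have [k k0 [w wE]] : exists2 k : nat, (0 < k)%N & exists w : int, k%:R * arc i = w%:~R * len i.
  exists (absz n); first by rewrite absz_gt0.
  case: (n) n0 E => m _ E; first by exists z.
  exists (- z); rewrite rmorphN mulNr -E NegzE /=.
  by rewrite rmorphN mulNr opprK.
move: tor; rewrite /torsion; case: asboolP => [irr _|_].
  have w0 : 0 < w%:~R :> R by rewrite -(pmulr_lgt0 _ l0) -wE mulr_gt0 ?ltr0n.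
  apply: irr; apply/rationalP; exists k%:Z, (absz w).
  have -> : (absz w)%:R = w%:~R :> R.
    by rewrite -[(absz w)%:R]/((absz w)%:~R) gez0_abs //; move: w0; rewrite ltr0z => /ltW.
  by apply/eqP; rewrite eqr_div ?lt0r_neq0 // mulrC -wE.
pose P m := (0 < m)%N && `[< exists w : int, m%:R * arc i = w%:~R * len i >].
have exP : exists m, P m by exists k; rewrite /P k0; apply/asboolP; exists w.
case: (ex_minnP exP) => m /andP[m0 /asboolP Pm] mmin.
case: xgetP => [m' -> [[+ _] _] m'0|none _]; first by rewrite m'0.
apply: (none m); split=> // j [j0 Pj]; apply: mmin.
by rewrite /P j0; apply/asboolP.
Qed.

End ChainRank.

(** * Martens-special chains *)

Section MartensSpecial.
Variables (R : realType) (g k : nat) (C : chain_of_cycles R g) (j : nat -> nat).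
Notation G := (chain_graph C).
Hypothesis j_range : forall n, (1 <= n <= k)%N -> (3 <= j n)%N /\ (j n + 2 <= g)%N.
Hypothesis j_gap : forall n, (1 <= n < k)%N -> (j n + 2 <= j n.+1)%N.
Hypothesis j_torsion : forall n, (1 <= n <= k)%N -> torsion C (j n) <> 2%N.
Hypothesis other_torsion : forall i, (2 <= i <= g)%N ->
  (forall n, (1 <= n <= k)%N -> i <> j n) -> torsion C i = 2%N.
Hypothesis C_general : general_chain C.

(* The cycles are processed from the last one to the first one: step [n]
   deals with the cycle of number [g - n]. *)
Definition special_step n : bool := (g - n)%N \in [seq j m | m <- iota 1 k].

Lemma special_stepP n : reflect (exists2 m, (1 <= m <= k)%N & (g - n)%N = j m)
                                (special_step n).
Proof.
apply: (iffP mapP) => -[m mk E]; exists m => //.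
  by move: mk; rewrite mem_iota add1n ltnS.
by rewrite mem_iota add1n ltnS.
Qed.

Lemma j_spread m n : (1 <= m < n)%N -> (n <= k)%N -> (j m + (n - m).*2 <= j n)%N.
Proof.
elim: n => [|n IH] /andP[m1 mn] nk; first by rewrite ltn0 in mn.
move: mn; rewrite ltnS leq_eqVlt => /predU1P[mn|mn].
  by have := @j_gap n; rewrite -mn m1 mn nk => /(_ isT); lia.
have := @j_gap n; rewrite nk (leq_ltn_trans (leq0n m) mn) => /(_ isT).
by have := IH; rewrite m1 mn (ltnW nk) => /(_ isT isT); lia.
Qed.

Lemma special_range n : special_step n -> (1 < n)%N /\ (n.+2 < g)%N.
Proof. by case/special_stepP=> m /j_range[]; lia. Qed.

Lemma special_gap n : special_step n -> ~~ special_step n.+1.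
Proof.
move=> /special_stepP[m mk E]; apply/negP => /special_stepP[m' mk' E'].
have [j3 _] := j_range mk'.
case: (ltngtP m m') => mm; last by move: E E'; rewrite mm; lia.
  by have := @j_spread m m'; rewrite mm; case/andP: mk => -> _; lia.
by have := @j_spread m' m; rewrite mm; case/andP: mk' => -> _; lia.
Qed.

Lemma ordinary_count n :
  (ordinary special_step n + count special_step (iota 0 n) = n)%N.
Proof.
elim: n => [|n IH]; first by rewrite /ordinary big_ord0.
rewrite ordinaryS -addn1 iotaD count_cat /= addn0 add0n.
by case: (special_step n) IH => /=; lia.
Qed.

Lemma ordinary_steps : (ordinary special_step g + k = g)%N.
Proof.
rewrite -[RHS](ordinary_count g); congr (_ + _)%N.
pose S := [seq (g - j m)%N | m <- iota 1 k].
have SP t : (t < g)%N -> special_step t = (t \in S).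
  move=> tg; apply/special_stepP/mapP => -[m mk E]; exists m.
  - by rewrite mem_iota add1n ltnS.
  - by lia.
  - by move: mk; rewrite mem_iota add1n ltnS.
  by have [|] := @j_range m; [move: mk; rewrite mem_iota add1n ltnS|lia].
have uS : uniq S.
  rewrite map_inj_in_uniq ?iota_uniq // => m n; rewrite !mem_iota !add1n !ltnS => mk nk.
  have [? ?] := j_range mk; have [? ?] := j_range nk => E.
  case: (ltngtP m n) => // mn.
    by have := @j_spread m n; rewrite mn; case/andP: mk => -> _; case/andP: nk; lia.
  by have := @j_spread n m; rewrite mn; case/andP: nk => -> _; case/andP: mk; lia.
have -> : k = size S by rewrite size_map size_iota.
rewrite -size_filter; apply: perm_size; apply: uniq_perm => //.
  by rewrite filter_uniq ?iota_uniq.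
move=> t; rewrite mem_filter mem_iota /= add0n andbC.
case: (ltnP t g) => [tg|gt]; first by rewrite SP.
apply/negbTE/mapP => -[m]; rewrite mem_iota add1n ltnS => /j_range[]; lia.
Qed.

(** The indices lie between 3 and [g - 2] with gaps of at least 2. This leaves room for a divisor of
    degree [k + 2] and rank 1 that contributes to the Clifford index. *)
Lemma genus_bound : (1 <= k)%N -> (k.*2 + 3 <= g)%N.
Proof.
move=> k1; have [|_ jk] := @j_range k; first by rewrite k1 leqnn.
have [|j1 _] := @j_range 1; first by rewrite k1.
case: (ltngtP 1 k) k1 => // [k1 _|k1 _]; last by rewrite -k1 in jk *; lia.
by have := @j_spread 1 k; rewrite k1 => /(_ isT (leqnn k)); lia.
Qed.

Lemma torsion_ordinary n : (n.+1 < g)%N -> ~~ special_step n ->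
  2%:R * arc_len C (g - n.+1).+1 = cyc_len C (g - n.+1).+1.
Proof.
move=> ng /special_stepP sn; apply: torsion2; first by lia.
apply: other_torsion => [|m mk E]; first by lia.
by apply: sn; exists m => //; lia.
Qed.

Lemma torsion_special n : special_step n -> torsion C (g - n.+1).+1 = 0%N.
Proof.
move=> /special_stepP[m mk E]; have [j3 jg] := j_range mk.
have -> : ((g - n.+1).+1 = j m)%N by lia.
by apply: C_general; [lia|apply: j_torsion].
Qed.

(** Two arcs make a full turn, so a multiple of the arc remembers only a parity. *)
Lemma fixes_parity (D : divisor G) n u v : (n.+1 < g)%N -> ~~ special_step n ->
  fixes D n u -> fixes D n v -> odd u = odd v.
Proof.
move=> ng /(torsion_ordinary ng) l2 /asboolP[z zE] /asboolP[w]; rewrite zE => E.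
have /andP[a0 _] : 0 < arc_len C (g - n.+1).+1 < cyc_len C (g - n.+1).+1.
  by apply: arc_bounds; lia.
have : u%:R + (2 * z)%:~R = v%:R + (2 * w)%:~R :> R.
  apply: (mulIf (lt0r_neq0 a0)); rewrite [LHS]mulrDl [RHS]mulrDl !rmorphM /=.
  rewrite -l2 in E; transitivity (u%:R * arc_len C (g - n.+1).+1
    + z%:~R * (2%:R * arc_len C (g - n.+1).+1)); first by ring.
  by rewrite E; ring.
by rewrite -[u%:R]/(u%:~R) -[v%:R]/(v%:~R) -!rmorphD => /intr_inj; lia.
Qed.

Lemma fixes_unique (D : divisor G) n u v : (n.+1 < g)%N -> special_step n ->
  fixes D n u -> fixes D n v -> u = v.
Proof.
move=> ng /torsion_special t0 /asboolP[z zE] /asboolP[w]; rewrite zE => E.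
have ig : (g - n.+1 < g)%N by lia.
have := torsion0 ig t0 (n := u%:Z - v%:Z) (z := w - z).
rewrite !rmorphB !mulrBl /=.
have -> : u%:~R * arc_len C (g - n.+1).+1 = v%:R * arc_len C (g - n.+1).+1
    + w%:~R * cyc_len C (g - n.+1).+1 - z%:~R * cyc_len C (g - n.+1).+1.
  by rewrite -E addrK.
move=> H; have : u%:Z - v%:Z = 0 by apply: H; ring.
by lia.
Qed.

(** The rectangle has sides [r + 1] and [g - deg D + r], which [contributes] makes at least 2.
    Bounding their sum minus one by [g - k] is the claim. *)
Lemma clifford_bound (D : divisor G) (r : int) : contributes D r -> k%:Z <= deg D - 2 * r.
Proof.
case; rewrite genus_chain; case: r => // r /has_rank_ge Mr r1 rB.
have [B BE] : exists B : nat, g%:Z - deg D + r%:Z = B%:Z.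
  by exists (absz (g%:Z - deg D + r%:Z)%R); rewrite gez0_abs //; lia.
have := @rectangle_bound (fixes D) g r.+1 B special_step.
rewrite subn1 /=; have := ordinary_steps.
move=> ord_g /(_ _ _ (@fixes_parity D) (@fixes_unique D) special_range special_gap).
have r1' : (1 < r.+1)%N by lia.
have B1 : (1 < B)%N by lia.
move=> /(_ r1' B1). lia.
Qed.

Lemma eqmod_parity i u v : 2%:R * arc_len C i.+1 = cyc_len C i.+1 -> odd u = odd v ->
  eqmod C i (u%:R * arc_len C i.+1) (v%:R * arc_len C i.+1).
Proof.
move=> l2 uv; exists (u./2%:Z - v./2%:Z).
have half (w : nat) : w%:R = (odd w)%:R + (w./2)%:R * 2%:R :> R.
  by rewrite -natrM -natrD muln2 odd_double_half.
by rewrite -l2 (half u) (half v) uv rmorphB /=; ring.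
Qed.

(** The rectangle with sides [r + 1] and [g - d + r] meets [K] antidiagonals, and [k + 2 * r <= d]
    says that the [g - k] ordinary steps are enough to fill them. *)
Lemma exists_ordinary_rank (d : int) (r : nat) :
  (0 < r)%N -> k%:Z + 2 * r%:Z <= d <= g%:Z + r%:Z - 2 ->
  exists2 D : divisor G, deg D = d & has_rank D r%:Z.
Proof.
move=> r0 dr; have ord_g := ordinary_steps.
have [K KE] : exists K : nat, g%:Z - d + 2 * r%:Z = K%:Z.
  by exists (absz (g%:Z - d + 2 * r%:Z)%R); rewrite gez0_abs //; lia.
pose N := ordinary special_step.
(* Special steps get a generic class. On the others the prescribed position has the parity of
   [n + N n], shared by all particles to be delayed; once [N n] reaches [r] it is the position of
   particle [r]. *)
have [D Dd DP] := exists_prescribed C d (fun n =>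
  if special_step n || (K <= N n)%N then None else Some (n + r.*2 - N n)%N).
exists D => //; apply: has_rank_exact; rewrite Dd.
rewrite (@particle_staircase _ g r K special_step); try lia.
- by move=> n u ng fr; have := DP n u ng; rewrite fr.
- move=> n ng sn NK; have := DP n (n + r.*2 - N n)%N ng.
  by rewrite (negbTE sn) leqNgt NK /=; apply; apply: eqmod_refl.
move=> n u ng sn NK uN; have := DP n u (ltnW ng).
rewrite (negbTE sn) leqNgt NK /=; apply; apply: eqmod_parity.
  exact: torsion_ordinary.
rewrite uN oddB ?oddD ?odd_double ?addbF //.
by have := ordinary_count n; rewrite /N; lia.
Qed.

End MartensSpecial.

Theorem theorem2 (R : realType) (g k : nat) (C : chain_of_cycles R g) :
  (1 <= k)%N ->
  martens_special C k ->
  general_chain C ->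
  divisorial_complete (chain_graph C).
Proof.
move=> k1 [_ [j [j_range j_gap j_torsion other_torsion]]] C_general.
have k_g := genus_bound j_range j_gap k1.
(* The Clifford index is [k], attained in degree [k + 2] and rank 1. *)
exists k%:Z.
  split; last exact: (clifford_bound j_range j_gap j_torsion other_torsion C_general).
  have [|D Dd Dr] := exists_ordinary_rank j_range j_gap other_torsion
    (d := k%:Z + 2) (r := 1) isT; first by lia.
  exists D, 1; split; last by rewrite Dd; lia.
  by split=> //; rewrite genus_chain Dd; lia.
move=> d r; rewrite genus_chain => -[[gd ->]|[d0 ->]|[gd ->]|[r1 dr]].
(* With generic classes everywhere no particle is delayed, and particle [n] ends at [g + n]. *)
- have [n nE] : exists n : nat, d - g%:Z = n%:Z.
    by exists (absz (d - g%:Z)%R); rewrite gez0_abs //; lia.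
  have [D Dd DP] := exists_prescribed C d (fun=> None).
  exists D => //; rewrite nE; apply: has_rank_exact; rewrite Dd.
  rewrite (particle_free _ (leq0n g)) => [|m u /andP[_ mg]]; last exact: DP.
  by rewrite /particle; lia.
(* Particle 0 has to be delayed [g - d] times; it waits at position 0 during the first steps. *)
- have [B BE] : exists B : nat, g%:Z - d = B%:Z.
    by exists (absz (g%:Z - d)%R); rewrite gez0_abs //; lia.
  have [D Dd DP] := exists_prescribed C d (fun n => if (n < B)%N then Some 0%N else None).
  exists D => //; apply: (@has_rank_exact _ _ _ _ 0); rewrite Dd.
  rewrite (@particle_row _ g B); try lia.
    move=> n nB; have ng : (n < g)%N by lia.
    by have := DP n 0%N ng; rewrite nB; apply; apply: eqmod_refl.
  by move=> n u /andP[Bn ng]; have := DP n u ng; rewrite ltnNge Bn.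
(* Particle [n] has to be delayed just once, which requires delaying each particle behind it
   first. *)
- have [n nE] : exists n : nat, d - g%:Z + 1 = n%:Z.
    by exists (absz (d - g%:Z + 1)%R); rewrite gez0_abs //; lia.
  have [D Dd DP] := exists_prescribed C d
    (fun m => if (m <= n)%N then Some m.*2 else None).
  exists D => //; rewrite nE; apply: has_rank_exact; rewrite Dd.
  rewrite (@particle_column _ g n); try lia.
    move=> m mn; have mg : (m < g)%N by lia.
    by have := DP m m.*2 mg; rewrite mn; apply; apply: eqmod_refl.
  by move=> m u /andP[nm mg]; have := DP m u mg; rewrite leqNgt nm.
case: r r1 dr => // r r1 dr.
exact: (exists_ordinary_rank j_range j_gap other_torsion).
Qed.
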